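(* There exists an absolute constant $C>0$ such that the following holds. Let $f\colon S_n\to\mathbb{R}$ be a nonzero class function with $\frac{\|f\|_2}{\|f\|_1}\le M$ for some real number $M$, and let $\chi$ be an irreducible character of $S_n$ of level $d\le\log M$. Then $$|\langle f,\chi\rangle|\le\chi(1)\,\|f\|_1\left(\frac{C\log M}{n\log\left(\frac{\log M}{d}\right)}\right)^{d}.$$
   Context: $S_n$ is the symmetric group on $n$ letters, and irreducible characters are the complex irreducible characters $\chi_\lambda$ indexed by partitions $\lambda=(\lambda_1\ge\lambda_2\ge\cdots)$ of $n$. Write $\lambda'$ for the conjugate partition, so $\lambda_1'$ is the number of parts of $\lambda$. The level of $\chi_\lambda$ is $\min(n-\lambda_1,\,n-\lambda_1')$. For functions on $S_n$, $\langle f,g\rangle=\frac{1}{n!}\sum_{\sigma\in S_n}f(\sigma)g(\sigma)$ and $\|f\|_p=\big(\frac{1}{n!}\sum_{\sigma\in S_n}|f(\sigma)|^p\big)^{1/p}$. A class function is a function constant on conjugacy classes. The logarithm is natural. Conventions for degenerate cases: when $d=0$ the $d$-th power on the right-hand side is $1$; when $d\ge1$ and $d=\log M$ (so that the denominator vanishes) the right-hand side is $+\infty$ (the bound is vacuous). *)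

(* Defs.v *)
From HB Require Import structures.
From mathcomp Require Import all_boot all_order all_algebra all_fingroup.
From mathcomp Require Import mxrepresentation.
From mathcomp Require Import boolp reals constructive_ereal exp.
From mathcomp Require Import complex.

Set Implicit Arguments.
Unset Strict Implicit.
Unset Printing Implicit Defensive.

Import Order.TTheory GRing.Theory Num.Theory.
Local Open Scope ring_scope.

Definition is_partition (n : nat) (la : seq nat) : bool :=
  [&& sorted geq la, all (leq 1) la & sumn la == n].

(* As the parts are positive, [size la] is the first part of the conjugate
   partition. *)
Definition partition_level (n : nat) (la : seq nat) : nat :=
  minn (n - head 0 la)%N (n - size la)%N.

(* Stabilisers of the rows and of the columns of the Young tableau of shape
   [la] whose rows, read one after the other, are 0, 1, ..., n - 1: the letter
   [i] lies in row [reshape_index la i] and column [reshape_offset la i]. *)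
Definition row_stab (n : nat) (la : seq nat) : {set 'S_n} :=
  [set s : 'S_n | [forall i, reshape_index la (s i) == reshape_index la i]].

Definition column_stab (n : nat) (la : seq nat) : {set 'S_n} :=
  [set s : 'S_n | [forall i, reshape_offset la (s i) == reshape_offset la i]].

(* The element (\sum_(p in row_stab) p) (\sum_(q in column_stab) sgn(q) q) of
   the group algebra, in the basis underlying [regular_repr]. *)
Definition young_symmetrizer (F : fieldType) (n : nat) (la : seq nat) :
    'rV[F]_#|[set: 'S_n]%G| :=
  \sum_(p in row_stab n la) \sum_(q in column_stab n la)
    (-1) ^+ odd_perm q *: delta_mx 0 (gring_index [set: 'S_n]%G (p * q)%g).

(* The Specht module of [la]. Representations act on row vectors, and
   [regular_repr] is multiplication on the right, so this is the right ideal
   generated by the Young symmetrizer; inside the span of the right cosets of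
   [row_stab] (the tabloids) it is the submodule generated by a polytabloid. *)
Definition specht_repr (F : fieldType) (n : nat) (la : seq nat) :=
  submod_repr (cyclic_mx_module (regular_repr F [set: 'S_n]%G)
                                (young_symmetrizer F n la)).

Definition specht_char (F : fieldType) (n : nat) (la : seq nat) (s : 'S_n) : F :=
  \tr (specht_repr F n la s).

Definition is_irr_char (R : realType) (n : nat) (chi : 'S_n -> R[i]) : Prop :=
  exists (m : nat) (rG : mx_representation R[i] [set: 'S_n]%G m),
    mx_irreducible rG /\ forall s, chi s = \tr (rG s).

Definition has_level (R : realType) (n : nat) (chi : 'S_n -> R[i]) (d : nat) :
    Prop :=
  exists la : seq nat,
    [/\ is_partition n la, chi =1 specht_char R[i] la
      & d = partition_level n la].

Definition is_class_function (T : Type) (n : nat) (f : 'S_n -> T) : Prop :=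
  forall s t : 'S_n, f (s ^ t)%g = f s.

(* Bilinear, without complex conjugation. *)
Definition inner (K : fieldType) (n : nat) (f g : 'S_n -> K) : K :=
  (n`!%:R)^-1 * \sum_(s : 'S_n) f s * g s.

Definition pnorm (R : realType) (n : nat) (p : R) (f : 'S_n -> R) : R :=
  ((n`!%:R)^-1 * \sum_(s : 'S_n) `|f s| `^ p) `^ p^-1.

(* When [d = 0] this is 1, by [expr0]. *)
Definition level_factor (R : realType) (C : R) (n : nat) (M : R) (d : nat) :
    \bar R :=
  if (0 < d)%N && (d%:R == ln M) then +oo%E
  else ((C * ln M / (n%:R * ln (ln M / d%:R))) ^+ d)%:E.

(* Main.v *)
Require Import Defs.
From mathcomp Require Import all_boot all_order all_algebra all_fingroup.
From mathcomp Require Import reals constructive_ereal exp.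
From mathcomp Require Import complex.
From mathcomp Require Import mxrepresentation sequences.
From mathcomp Require Import lra ring zify.

Import Order.TTheory GRing.Theory Num.Theory.
Local Open Scope ring_scope.

Set Implicit Arguments.
Unset Strict Implicit.
Unset Printing Implicit Defensive.

(** Let chi be irreducible of level d, and let H_D be the pointwise stabiliser
    of a set D of letters.  After multiplying chi by the sign if necessary, the
    representation has a nonzero H_D-invariant vector when #|D| = d, and none
    when #|D| < d: the first row (or column) of the tableau supplies the
    invariant vector ([row_specht_sum_neq0], [column_specht_sum_neq0]), and on
    more than lambda_1 letters two of them share a column, so that a
    transposition makes the sum over H_D equal to its opposite
    ([row_specht_sum0], [column_specht_sum0]).

    Fix a unitary structure and an H_D-invariant vector v, and write
    phi(g) = <g v, v>.  By Schur's lemma chi(s) / chi(1) is the average of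
    phi(s ^ t) / phi(1) over t ([invariant_coef_class_sum]).  The absence of
    H_(D minus x)-invariants is the relation
      sum over y outside D minus x of phi((x y) g) = 0,
    in which every y that g sends outside D contributes phi(g) itself.  It
    bounds phi(g) by d / (n - 2d) times the largest value of |phi| at permutations
    that send one letter fewer of D outside D; hence
      |phi(g)| <= (d / (n - 2d)) ^ m phi(1),   m = #|g D minus D|
    ([invariant_coef_decay]).  So |chi(s)| / chi(1) is at most the average over
    all D of size d of (d / (n - 2d)) ^ #|s D minus D| ([char_decay]).

    A set D is determined by the union of the s-cycles that it contains and by
    the lengths of the runs in which D follows the other cycles.  Weighting a
    run of length l by 2 ^ -l, this gives, for 4 d <= n,
      |chi(s)| <= chi(1) (4 e^2 d / n) ^ d N(s)
    where N(s) counts the s-invariant sets with at most d elements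
    ([boundary_sum], [irr_char_bounds]).

    The moment E N^Q is the number of orbits of S_n on Q-tuples of sets with at
    most d elements, that is on certain maps from the letters to the subsets of
    a Q-set.  An orbit is determined by the fibre sizes of the map, and
    Rankin's trick with x = log Q / Q bounds the number of possible fibre sizes
    by (Q / log Q) ^ (Q d) e ^ (2 Q) ([invariant_sets_log_moment]).

    Finally <f, chi> is estimated by testing |f| against N, using its L1 and L2
    norms and the moment of order Q = 2 k, k close to log M / d, for which
    M ^ (1 / k) <= e ^ d ([weighted_sum_le], [level_bound]).  If n < 4 d, or if
    d = 0, the trivial bound |chi(s)| <= chi(1) is enough. *)

Lemma widen_ord_inj (m n : nat) (le_mn : (m <= n)%N) : injective (widen_ord le_mn).
Proof. by move=> i j /(congr1 val) /= /ord_inj. Qed.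

(** * Sums over a subgroup in a representation *)

(** The trace of a quasi-idempotent is c times its rank. *)
Lemma trace0_quasi_idempotent (F : numFieldType) (m : nat) (c : F) (A : 'M[F]_m) :
  c != 0 -> A *m A = c *: A -> \tr A = 0 -> A = 0.
Proof.
move=> c0 AA trA.
have rc : row_base A *m col_base A = c%:M.
  apply: (row_full_inj (col_base_full A)); apply: (row_free_inj (row_base_free A)).
  rewrite -(mulmxA (col_base A)) -(mulmxA (row_base A)) mulmx_base.
  by rewrite mulmxA mulmx_base AA mul_mx_scalar -scalemxAl mulmx_base.
move: trA; rewrite -{1}(mulmx_base A) mxtrace_mulC rc mxtrace_scalar => /eqP.
rewrite mulrn_eq0 (negbTE c0) orbF => /eqP r0.
by apply/eqP; rewrite -mxrank_eq0 r0.
Qed.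

Section Average.
Variables (F : numFieldType) (gT : finGroupType) (m : nat).
Variable rG : mx_representation F [set: gT] m.

Definition subgroup_sum (H : {set gT}) : 'M[F]_m := \sum_(h in H) rG h.

Lemma subgroup_sum_mulr (H : {group gT}) h :
  h \in H -> subgroup_sum H *m rG h = subgroup_sum H.
Proof.
move=> Hh; rewrite mulmx_suml (reindex_inj (mulIg (h^-1)%g)) /=.
apply: eq_big => [g|g _]; first by rewrite groupMr ?groupV.
by rewrite -repr_mxM ?inE // mulgKV.
Qed.

Lemma subgroup_sum_idem (H : {group gT}) :
  subgroup_sum H *m subgroup_sum H = #|H|%:R *: subgroup_sum H.
Proof.
rewrite {2}/subgroup_sum mulmx_sumr.
under eq_bigr => h Hh do rewrite subgroup_sum_mulr //.
by rewrite sumr_const scaler_nat.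
Qed.

(** Vanishing of a sum over a subgroup depends on the character only, which
    transfers it between representations with the same character. *)
Lemma subgroup_sum_eq0 (H : {group gT}) :
  (subgroup_sum H == 0) = (\sum_(h in H) \tr (rG h) == 0).
Proof.
rewrite -linear_sum /= -/(subgroup_sum H).
apply/eqP/eqP => [->|]; first by rewrite linear0.
apply: trace0_quasi_idempotent (subgroup_sum_idem H).
by rewrite pnatr_eq0 -lt0n cardG_gt0.
Qed.

End Average.

(** * Twisting a representation by a linear character *)

Section Twist.
Variables (F : fieldType) (gT : finGroupType) (m : nat).
Variables (psi : gT -> F) (rG : mx_representation F [set: gT] m).
Hypothesis psi1 : psi 1%g = 1.
Hypothesis psiM : {morph psi : x y / (x * y)%g >-> x * y}.

Definition twist_mx (x : gT) : 'M[F]_m := psi x *: rG x.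

Lemma twist_mx_repr : mx_repr [set: gT] twist_mx.
Proof.
rewrite /twist_mx; split=> [|x y Gx Gy]; first by rewrite psi1 scale1r repr_mx1.
by rewrite psiM repr_mxM // -scalemxAl -scalemxAr scalerA.
Qed.

Definition twist_repr := MxRepresentation twist_mx_repr.

Lemma psi_neq0 x : psi x != 0.
Proof.
apply: contraTneq (oner_neq0 F) => px; rewrite negbK.
by rewrite -psi1 -(mulgV x) psiM px mul0r.
Qed.

Lemma twist_irreducible : mx_irreducible rG -> mx_irreducible twist_repr.
Proof.
move=> /mx_irrP[m0 irr]; apply/mx_irrP; split=> // U modU; apply: irr.
apply/mxmoduleP=> x Gx; have := mxmoduleP modU x Gx.
by rewrite /= /twist_mx -scalemxAr eqmx_scale ?psi_neq0.
Qed.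

End Twist.

(** * Coefficients for the invariant Hermitian form *)

Section Positive.
Variables (F : numClosedFieldType) (gT : finGroupType) (m : nat).
Variables (rG : mx_representation F [set: gT] m) (v : 'rV[F]_m).

(** This is <v A, v> for the invariant Hermitian form obtained by averaging the
    standard one over the group. *)
Definition invariant_coef (A : 'M[F]_m) : F :=
  \sum_(g : gT) \sum_j (v *m A *m rG g) 0 j * ((v *m rG g) 0 j)^*.

Lemma invariant_coef_sum (I : Type) (r : seq I) (P : pred I) (E : I -> 'M[F]_m) :
  invariant_coef (\sum_(i <- r | P i) E i) = \sum_(i <- r | P i) invariant_coef (E i).
Proof.
rewrite /invariant_coef [RHS]exchange_big; apply: eq_bigr => g _ /=.
rewrite [RHS]exchange_big; apply: eq_bigr => j _ /=.
by rewrite mulmx_sumr mulmx_suml summxE mulr_suml.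
Qed.

Lemma invariant_coefZ a A : invariant_coef (a *: A) = a * invariant_coef A.
Proof.
rewrite /invariant_coef mulr_sumr; apply: eq_bigr => g _.
rewrite mulr_sumr; apply: eq_bigr => j _.
by rewrite -scalemxAr -scalemxAl mxE mulrA.
Qed.

Lemma invariant_coef1 :
  invariant_coef 1%:M = \sum_(g : gT) \sum_j `|(v *m rG g) 0 j| ^+ 2.
Proof.
apply: eq_bigr => g _; apply: eq_bigr => j _.
by rewrite mulmx1 normCK.
Qed.

Lemma invariant_coef1_gt0 : v != 0 -> 0 < invariant_coef 1%:M.
Proof.
move=> v0; rewrite invariant_coef1 lt_def sumr_ge0 ?andbT; last first.
  by move=> g _; apply: sumr_ge0 => j _; rewrite exprn_ge0.
rewrite psumr_neq0 => [|g _]; last by apply: sumr_ge0 => j _; rewrite exprn_ge0.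
apply/hasP; exists 1%g; rewrite ?mem_index_enum //= repr_mx1 mulmx1.
rewrite lt_def sumr_ge0 ?andbT => [|j _]; last by rewrite exprn_ge0.
rewrite psumr_neq0 => [|j _]; last by rewrite exprn_ge0.
have [j vj] : exists j, v 0 j != 0 by apply/rV0Pn.
by apply/hasP; exists j; rewrite ?mem_index_enum //= exprn_gt0 ?normr_gt0.
Qed.

Lemma invariant_coef_le (s : gT) : `|invariant_coef (rG s)| <= invariant_coef 1%:M.
Proof.
pose N g := \sum_j `|(v *m rG g) 0 j| ^+ 2.
have ->: invariant_coef 1%:M = \sum_(g : gT) \sum_j
    (`|(v *m rG (s * g)%g) 0 j| ^+ 2 + `|(v *m rG g) 0 j| ^+ 2) / 2.
  under [RHS]eq_bigr => g _ do rewrite -mulr_suml big_split /=.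
  rewrite -mulr_suml big_split /= -/(N _).
  have -> : \sum_g N (s * g)%g = invariant_coef 1%:M.
    by rewrite invariant_coef1 [RHS](reindex_inj (mulgI s)).
  by rewrite -invariant_coef1; field.
apply: le_trans (ler_norm_sum _ _ _) _; apply: ler_sum => g _.
apply: le_trans (ler_norm_sum _ _ _) _; apply: ler_sum => j _.
rewrite -mulmxA -repr_mxM ?inE // normrM norm_conjC.
set a := `|_|; set b := `|_|.
(* The Cauchy-Schwarz inequality for two vectors of equal norm is the
   inequality between arithmetic and geometric means, term by term. *)
rewrite ler_pdivlMr // -subr_ge0.
have -> : a ^+ 2 + b ^+ 2 - a * b * 2 = (a - b) ^+ 2 by ring.
by rewrite real_exprn_even_ge0 // rpredB // ?normr_real.
Qed.

Lemma invariant_coef_mull h s : v *m rG h = v -> invariant_coef (rG (h * s)%g) = invariant_coef (rG s).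
Proof.
move=> vh; apply: eq_bigr => g _; apply: eq_bigr => j _.
by rewrite repr_mxM ?inE // mulmxA vh.
Qed.

Lemma invariant_coef_mulr h s : v *m rG h = v -> invariant_coef (rG (s * h)%g) = invariant_coef (rG s).
Proof.
move=> vh; rewrite /invariant_coef (reindex_inj (mulgI (h^-1)%g)); apply: eq_bigr => g _ /=.
apply: eq_bigr => j _.
rewrite -mulmxA -repr_mxM ?inE // mulgA mulgK.
have ->: v *m rG (h^-1 * g)%g = v *m rG g; last by rewrite repr_mxM ?inE // mulmxA.
by rewrite repr_mxM ?inE // -[in LHS]vh !mulmxA repr_mxK ?inE.
Qed.

(** The average of the conjugates of s acts as a scalar, by Schur's lemma; its
    trace identifies the scalar as chi(s) / chi(1). *)
Lemma invariant_coef_class_sum (s : gT) : mx_irreducible rG ->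
  \sum_(t : gT) invariant_coef (rG (s ^ t)%g) * \tr (rG 1%g) =
  #|gT|%:R * \tr (rG s) * invariant_coef 1%:M.
Proof.
move=> irr; set A := \sum_(t : gT) rG (s ^ t)%g.
have absG : mx_absolutely_irreducible rG.
  by have := @group_closure_closed_field F gT [set: gT]%G _ rG; apply.
have cA : centgmx rG A.
  apply/centgmxP => x Gx; rewrite mulmx_suml mulmx_sumr.
  rewrite [RHS](reindex_inj (mulIg x)); apply: eq_bigr => t _ /=.
  by rewrite -!repr_mxM ?inE // conjgM conjgC.
have /is_scalar_mxP[a Aa] := mx_abs_irr_cent_scalar absG cA.
rewrite -mulr_suml -invariant_coef_sum -/A Aa repr_mx1.
have -> : invariant_coef a%:M = a * invariant_coef 1%:M by rewrite -invariant_coefZ scalemx1.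
rewrite mulrAC; congr (_ * _).
have <- : \tr A = a * \tr (1%:M : 'M[F]_m).
  by rewrite Aa -mxtraceZ scalemx1.
rewrite linear_sum /=; under eq_bigr => t _.
  rewrite conjgE !repr_mxM ?inE // mulmxA mxtrace_mulC !mulmxA.
  rewrite -repr_mxM ?inE // mulgV repr_mx1 mul1mx.
  over.
by rewrite sumr_const cardT -cardE mulr_natl.
Qed.

End Positive.

(** * Permutations and fibres *)

Lemma same_fibres_perm (n : nat) (T : eqType) (f g : 'I_n -> T) :
  (forall y, #|[set i | f i == y]| = #|[set i | g i == y]|) ->
  exists s : 'S_n, forall i, f i = g (s i).
Proof.
move=> fg; have cnt (h : 'I_n -> T) y :
    count_mem y [tuple h i | i < n] = #|[set i | h i == y]|.
  rewrite /= count_map -sum1_count -sum1_card big_enum_cond.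
  by apply: eq_bigl => i; rewrite /= !inE.
have /tuple_permP[s st] : perm_eq [tuple f i | i < n] [tuple g i | i < n].
  by apply/allP => y _ /=; apply/eqP; rewrite !cnt fg.
exists s => i.
have /(congr1 (fun u : n.-tuple T => tnth u i)) : [tuple f i | i < n] =
   [tuple tnth [tuple g i | i < n] (s i) | i < n] by apply: val_inj.
by rewrite !tnth_mktuple.
Qed.

Lemma same_card_imset (n : nat) (A B : {set 'I_n}) :
  #|A| = #|B| -> exists s : 'S_n, B = s @: A.
Proof.
move=> AB; have [s sP] : exists s : 'S_n, forall i, (i \in A) = (s i \in B).
  apply: (@same_fibres_perm n bool (mem A) (mem B)) => -[].
    have E (C : {set 'I_n}) : [set i | mem C i == true] = C.
      by apply/setP => i; rewrite inE eqb_id.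
    by rewrite !E.
  have E (C : {set 'I_n}) : [set i | mem C i == false] = ~: C.
    by apply/setP => i; rewrite !inE eqbF_neg.
  by rewrite !E [LHS]cardsCs [RHS]cardsCs !setCK AB.
exists s; apply/setP => i; apply/idP/imsetP => [iB|[j jA ->]]; last by rewrite -sP.
by exists (s^-1%g i); rewrite ?sP ?permKV.
Qed.

Lemma fixesP (n : nat) (D : {set 'I_n}) (s : 'S_n) :
  reflect (forall i, i \in D -> s i = i) (s \in 'C(D | 'P)%g).
Proof.
by apply: (iffP astabP) => sD i iD; have := sD i iD; rewrite /= apermE.
Qed.

(** * Decay of coefficients on the symmetric group *)

Section Decay.
Variables (F : numClosedFieldType) (n m : nat).
Variables (rG : mx_representation F [set: 'S_n] m) (v : 'rV[F]_m) (D : {set 'I_n}).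
Hypothesis vD : forall h, h \in 'C(D | 'P)%g -> v *m rG h = v.
Hypothesis vDx : forall x, x \in D ->
  v *m subgroup_sum rG 'C(D :\ x | 'P)%g = 0.
Local Notation phi g := (invariant_coef rG v (rG g)).

(** The cosets of the stabiliser of D in that of D minus x are represented by
    the transpositions of x with the letters y outside D minus x, so the absence
    of invariants for the larger stabiliser becomes a relation between these
    transpositions. *)
Lemma invariant_coef_exchange (x : 'I_n) (g : 'S_n) : x \in D ->
  \sum_(y | y \notin D :\ x) phi (tperm x y * g)%g = 0.
Proof.
move=> xD.
have S0 : \sum_(h in 'C(D :\ x | 'P)%g) phi (h * g)%g = 0.
  rewrite -invariant_coef_sum; apply: etrans (_ : invariant_coef rG v
    (subgroup_sum rG 'C(D :\ x | 'P)%g *m rG g) = 0).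
    congr invariant_coef; rewrite mulmx_suml; apply: eq_bigr => h _.
    by rewrite repr_mxM ?inE.
  apply: big1 => k _; apply: big1 => j _.
  by rewrite !mulmxA vDx // !mul0mx mxE mul0r.
have: #|('C(D | 'P)%g : {set 'S_n})|%:R *
    \sum_(y | y \notin D :\ x) phi (tperm x y * g)%g = 0 :> F.
  rewrite -[RHS]S0 mulr_sumr.
  rewrite [RHS](partition_big (fun h : 'S_n => h x) (fun y => y \notin D :\ x)) /=;
     last first.
    move=> h /fixesP hD; apply/negP => hxD.
    have /perm_inj hx : h (h x) = h x by apply: hD.
    by move: hxD; rewrite hx !inE eqxx.
  apply: eq_bigr => y yD.
  rewrite (reindex_inj (mulIg (tperm x y))) /=.
  rewrite mulr_natl -sumr_const; apply: eq_big => k.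
    apply/fixesP/andP => [kD|[/fixesP kD /eqP kx] i iD].
      split; last by rewrite permM kD // tpermL.
      apply/fixesP => i iDx; rewrite permM kD; last by case/setD1P: iDx.
      rewrite tpermD //; first by case/setD1P: iDx; rewrite eq_sym.
      by apply: contraNneq yD => ->.
    have [->|xi] := eqVneq i x.
      by apply: (@perm_inj _ (tperm x y)); rewrite -permM kx tpermL.
    apply: (@perm_inj _ (tperm x y)); rewrite -permM kD ?inE ?xi //.
    rewrite tpermD //; first by rewrite eq_sym.
    by apply: contraNneq yD => ->; rewrite !inE xi.
  by move=> kD; rewrite -mulgA [RHS]invariant_coef_mull ?vD.
move/eqP; rewrite mulf_eq0 pnatr_eq0 => /orP[|/eqP//].
by rewrite eqn0Ngt cardG_gt0.
Qed.

(** In the exchange relation for a letter x of D that g sends outside D, each y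
    with g y outside D contributes invariant_coef at g itself, since
    the transposition of g x and g y fixes v; there are at least n - 2d such y.  The at most d other values of y bring g x back into D. *)
Lemma invariant_coef_decay (d : nat) (g : 'S_n) :
  #|D| = d -> (2 * d < n)%N ->
  `|phi g| <= (d%:R / (n - 2 * d)%:R) ^+ #|(g @: D) :\: D| * invariant_coef rG v 1%:M.
Proof.
move=> cD dn; set t := _ / _.
have nd0 : 0 < (n - 2 * d)%:R :> F by rewrite ltr0n subn_gt0.
move Em : #|_| => m'; elim: m' g Em => [|k IH] g Em.
  by rewrite expr0 mul1r invariant_coef_le.
have [z] : exists z, z \in (g @: D) :\: D.
  by apply/set0Pn; rewrite -card_gt0 Em.
rewrite inE => /andP[gxD /imsetP[x xD zE]]; subst z.
have := invariant_coef_exchange g xD; rewrite (bigID (fun y => g y \in D)) /=.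
set B := \sum_(_ | _) _; set A := \sum_(_ | _) _ => BA.
have cardA : (n - 2 * d <= #|[pred y | (y \notin D :\ x) && (g y \notin D)]|)%N.
  rewrite leq_subLR -[X in (X <= _)%N](card_ord n).
  rewrite -(cardC [pred y | (y \notin D :\ x) && (g y \notin D)]) addnC leq_add2r.
  apply: leq_trans (_ : #|(D :\ x) :|: g @^-1: D| <= _)%N.
    apply: subset_leq_card; apply/subsetP => y; rewrite !inE.
    by rewrite negb_and !negbK.
  apply: leq_trans (leq_card_setU _ _) _; rewrite mul2n -addnn leq_add //.
    by rewrite -cD subset_leq_card // subD1set.
  by rewrite card_preimset ?cD //; apply: perm_inj.
have AE : A = #|[pred y | (y \notin D :\ x) && (g y \notin D)]|%:R * phi g.
  rewrite mulr_natl -sumr_const; apply: eq_bigr => y /andP[yD gyD].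
  rewrite conjgC tpermJ invariant_coef_mulr // vD //; apply/fixesP => i iD.
  by rewrite tpermD //; [apply: contraNneq gxD|apply: contraNneq gyD] => ->.
have Bb : `|B| <= d%:R * (t ^+ k * invariant_coef rG v 1%:M).
  apply: le_trans (ler_norm_sum _ _ _) _.
  apply: le_trans (_ : \sum_(y in g @^-1: D) t ^+ k * invariant_coef rG v 1%:M <= _);
    last by rewrite sumr_const card_preimset ?cD ?mulr_natl //; apply: perm_inj.
  rewrite big_mkcond [leRHS]big_mkcond; apply: ler_sum => y _.
  case: ifP => [/andP[yD gyD]|_]; last first.
    case: ifP => // _; apply: mulr_ge0; last exact: le_trans (invariant_coef_le _ _ 1%g).
    by rewrite exprn_ge0 // divr_ge0 // ler0n.
  rewrite inE gyD; apply: IH; apply/eqP; rewrite -eqSS -Em.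
  rewrite [X in _ == X](cardsD1 (g x)) inE gxD imset_f // add1n eqSS.
  apply/eqP; congr #|pred_of_set _|; apply/setP => i; rewrite !inE.
  case iD: (i \in D) => /=; first by rewrite andbF.
  apply/imsetP/andP => [[w wD iE]|[igx /imsetP[w wD iE]]].
    rewrite iE permM in iD *; have [wx|wx] := eqVneq w x.
      by move: iD; rewrite wx tpermL gyD.
    have yw : y != w by apply: contraNneq yD => ->; rewrite !inE wx.
    rewrite tpermD //; last by rewrite eq_sym.
    by rewrite (inj_eq perm_inj); split=> //; apply: imset_f.
  have wx : w != x by apply: contraNneq igx => <-; rewrite iE.
  exists w => //; rewrite permM tpermD //; first by rewrite eq_sym.
  by apply: contraNneq yD => ->; rewrite !inE wx.
have : `|A| <= d%:R * (t ^+ k * invariant_coef rG v 1%:M).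
  by rewrite (_ : A = - B) ?normrN //; apply/eqP; rewrite -addr_eq0 addrC BA.
rewrite AE normrM normr_nat => Ab.
have {Ab} : (n - 2 * d)%:R * `|phi g| <= d%:R * (t ^+ k * invariant_coef rG v 1%:M).
  by apply: le_trans Ab; rewrite ler_wpM2r // ler_nat.
rewrite mulrC -ler_pdivlMr // => /le_trans -> //.
by rewrite exprS /t le_eqVlt; apply/orP; left; apply/eqP; ring.
Qed.

End Decay.

Section CharBound.
Variables (F : numClosedFieldType) (n m : nat).
Variable rG : mx_representation F [set: 'S_n] m.
Hypothesis irr : mx_irreducible rG.

(** A coefficient is largest at 1, and chi(s) / chi(1) is an average of
    coefficients normalised by their value at 1. *)
Lemma char_norm_le1 (s : 'S_n) : `|\tr (rG s)| <= \tr (rG 1%g).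
Proof.
have [m0 _] := (mx_irrP rG).1 irr.
have [v v0] : exists v : 'rV[F]_m, v != 0.
  exists (delta_mx 0 (Ordinal m0)); apply/eqP => /rowP/(_ (Ordinal m0)).
  by rewrite !mxE !eqxx => /eqP; rewrite oner_eq0.
have c0 := invariant_coef1_gt0 rG v0.
have N0 : 0 < #|'S_n|%:R :> F by rewrite ltr0n; apply/card_gt0P; exists 1%g.
have t0 : 0 <= \tr (rG 1%g) by rewrite repr_mx1 mxtrace1 ler0n.
rewrite -(ler_pM2l N0) -(ler_pM2r c0).
have <- : `|#|'S_n|%:R * \tr (rG s) * invariant_coef rG v 1%:M| =
    #|'S_n|%:R * `|\tr (rG s)| * invariant_coef rG v 1%:M.
  by rewrite !normrM normr_nat (gtr0_norm c0).
rewrite -invariant_coef_class_sum // -mulr_suml normrM [X in _ * X](ger0_norm t0) mulrAC.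
rewrite ler_wpM2r //; apply: le_trans (ler_norm_sum _ _ _) _.
apply: le_trans (ler_sum _ (fun t _ => invariant_coef_le rG v (s ^ t)%g)) _.
by rewrite sumr_const mulr_natl.
Qed.

(** Averaging the bound on coefficients over conjugates of s amounts to
    averaging over D: conjugation of s moves D, and the bound is available for
    every D of size d because these sets are conjugate. *)
Lemma char_decay (d : nat) (s : 'S_n) :
  (2 * d < n)%N ->
  (forall D : {set 'I_n}, (#|D| < d)%N -> subgroup_sum rG 'C(D | 'P)%g = 0) ->
  (exists2 D : {set 'I_n}, #|D| = d & subgroup_sum rG 'C(D | 'P)%g != 0) ->
  `|\tr (rG s)| * 'C(n, d)%:R <= \tr (rG 1%g) *
    \sum_(D : {set 'I_n} | #|D| == d)
      (d%:R / (n - 2 * d)%:R) ^+ #|(s @: D) :\: D|.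
Proof.
move=> dn inv0 [D0 cD0 invD0]; set t := _ / _.
have N0 : 0 < #|'S_n|%:R :> F by rewrite ltr0n; apply/card_gt0P; exists 1%g.
have t0 : 0 <= \tr (rG 1%g) by rewrite repr_mx1 mxtrace1 ler0n.
have invD (D : {set 'I_n}) : #|D| = d -> subgroup_sum rG 'C(D | 'P)%g != 0.
  move=> cD; have [u uD] : exists u : 'S_n, D = u @: D0.
    by apply: same_card_imset; rewrite cD cD0.
  move: invD0; rewrite !subgroup_sum_eq0; congr (_ != 0).
  rewrite [RHS](reindex_inj (conjg_inj u)) /=; apply: eq_big => h.
    apply/fixesP/fixesP => [hD i|hD i iD].
      by rewrite uD => /imsetP[j jD ->]; rewrite permJ hD.
    by apply: (@perm_inj _ u); rewrite -permJ hD // uD imset_f.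
  move=> _; rewrite conjgE !repr_mxM ?inE // mxtrace_mulC -mulmxA.
  by rewrite -repr_mxM ?inE // mulgV repr_mx1 mulmx1.
have bound (D : {set 'I_n}) : #|D| = d ->
    #|'S_n|%:R * `|\tr (rG s)| <=
    \tr (rG 1%g) * \sum_(u : 'S_n) t ^+ #|((s ^ u)%g @: D) :\: D|.
  move=> cD; have /matrix0Pn[i [j vij]] := invD _ cD.
  pose v := row i (subgroup_sum rG 'C(D | 'P)%g).
  have v0 : v != 0 by apply/rV0Pn; exists j; rewrite mxE.
  have c0 := invariant_coef1_gt0 rG v0.
  rewrite -(ler_pM2r c0).
  have <- : `|#|'S_n|%:R * \tr (rG s) * invariant_coef rG v 1%:M| =
      #|'S_n|%:R * `|\tr (rG s)| * invariant_coef rG v 1%:M.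
    by rewrite !normrM normr_nat (gtr0_norm c0).
  rewrite -invariant_coef_class_sum // -mulr_suml.
  rewrite normrM [X in _ * X <= _](ger0_norm t0) mulrC -mulrA.
  rewrite ler_wpM2l // mulr_suml.
  apply: le_trans (ler_norm_sum _ _ _) _; apply: ler_sum => u _.
  apply: invariant_coef_decay => // [h hD|x xD].
    by rewrite /v -row_mul subgroup_sum_mulr.
  by rewrite inv0 ?mulmx0 // -cD [X in (_ < X)%N](cardsD1 x) xD.
rewrite -(ler_pM2l N0) mulrA.
have <- : \sum_(D : {set 'I_n} | #|D| == d) #|'S_n|%:R * `|\tr (rG s)| =
   #|'S_n|%:R * `|\tr (rG s)| * 'C(n, d)%:R.
  have <- : 'C(#|[set: 'I_n]|, d) = 'C(n, d) by rewrite cardsT card_ord.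
  rewrite -cards_draws mulr_natr -[RHS]sumr_const.
  by apply: eq_bigl => D; rewrite !inE subsetT.
apply: le_trans (ler_sum _ (fun D cD => bound D (eqP cD))) _.
rewrite -mulr_sumr mulrCA ler_wpM2l // exchange_big /=.
rewrite mulr_natl -sumr_const; apply: ler_sum => u _.
rewrite [leRHS](reindex_inj (imset_inj (@perm_inj _ (u^-1)%g))) /=.
rewrite le_eqVlt; apply/orP; left; apply/eqP; apply: eq_big => D.
  by rewrite card_imset //; apply: perm_inj.
move=> _; congr (_ ^+ _).
rewrite -[RHS](card_imset _ (@perm_inj _ u)); congr #|pred_of_set _|.
have K (A : {set 'I_n}) : u @: ((u^-1)%g @: A) = A.
  by rewrite -imset_comp -[RHS]imset_id; apply: eq_imset => i /=; rewrite permKV.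
have ID (A B : {set 'I_n}) : u @: (A :\: B) = (u @: A) :\: (u @: B).
  apply/setP => i; rewrite -(permKV u i).
  by rewrite inE !(mem_imset _ _ (@perm_inj _ u)) inE.
rewrite ID K; congr (_ :\: _); rewrite -!imset_comp; apply: eq_imset => i /=.
by rewrite conjgE !permM.
Qed.

End CharBound.

(** * Invariants of Specht modules *)

Section Cyclic.
Variables (F : fieldType) (gT : finGroupType).
Local Notation aG := (regular_repr F [set: gT]%G).
Local Notation e x := (delta_mx 0 (gring_index [set: gT]%G x) : 'rV[F]_#|[set: gT]%G|).

Lemma delta_regular x z : e x *m aG z = e (x * z)%g.
Proof. by rewrite -rowE rowK gring_indexK ?inE. Qed.

Variables (y : 'rV[F]_#|[set: gT]%G|) (psi : gT -> F) (H : {set gT}).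
Local Notation rho := (submod_repr (cyclic_mx_module aG y)).

Lemma cyclic_sum0 :
  (forall g, \sum_(h in H) psi h *: (y *m aG (g * h)%g) = 0) ->
  \sum_(h in H) psi h *: rho h = 0.
Proof.
move=> y0; apply: val_submod_inj; rewrite linear0 linear_sum /=.
have E h : val_submod (submod_mx (cyclic_mx_module aG y) h) =
           val_submod 1%:M *m aG h.
  by rewrite -[X in val_submod X]mul1mx val_submodJ ?inE.
under eq_bigr => h _ do rewrite linearZ /= E scalemxAr.
rewrite -mulmx_sumr; apply/row_matrixP => i; rewrite row_mul row0.
have : (row i (val_submod (1%:M : 'M_(\rank (cyclic_mx aG y)))) <= cyclic_mx aG y)%MS.
  by apply: submx_trans (row_sub _ _) (val_submodP _).
case/cyclic_mxP => A /envelop_mxP[a ->] ->.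
rewrite -mulmxA mulmx_suml mulmx_sumr big1 // => g _.
rewrite -scalemxAl -scalemxAr mulmx_sumr mulmx_sumr.
apply/eqP; rewrite scaler_eq0; apply/orP; right; apply/eqP.
rewrite -[RHS](y0 g); apply: eq_bigr => h _.
by rewrite -!scalemxAr repr_mxM ?inE.
Qed.

Lemma cyclic_sum_neq0 :
  \sum_(h in H) psi h *: (y *m aG h) != 0 ->
  \sum_(h in H) psi h *: rho h != 0.
Proof.
move=> y0; apply: contraNneq y0 => r0; apply/eqP.
have := congr1 (fun A => val_submod (in_submod (cyclic_mx aG y) y *m A)) r0.
rewrite mulmx0 linear0 mulmx_sumr linear_sum /= => E.
apply: etrans E; apply: eq_bigr => h _.
by rewrite -scalemxAr linearZ /= val_submodJ ?inE // in_submodK ?cyclic_mx_id.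
Qed.

End Cyclic.

(** Replacing q by q t' and h by t h permutes the terms of the double sum and
    changes all their signs. *)
Lemma sign_cancel (F : numFieldType) (gT : finGroupType) (V : lmodType F)
    (C : {set gT}) (H : {group gT}) (w : gT -> gT -> F) (e : gT -> V) (g t t' : gT) :
  t \in H -> (forall q, (q * t' \in C)%g = (q \in C)) -> (t' * g * t = g)%g ->
  (forall q h, w (q * t')%g (t * h)%g = - w q h) ->
  \sum_(q in C) \sum_(h in H) w q h *: e (q * g * h)%g = 0.
Proof.
move=> Ht Ct tgt wN; set T := \sum_(q in C) _.
have TN : T = - T.
  rewrite {1}/T (reindex_inj (mulIg t')) /= -sumrN.
  apply: eq_big => [q|q _]; first exact: Ct.
  rewrite (reindex_inj (mulgI t)) /= -sumrN.
  apply: eq_big => [h|h _]; first by rewrite groupMl.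
  by rewrite wN scaleNr -!mulgA (mulgA g) (mulgA t') (mulgA t' g) tgt.
apply/eqP; have : 2 *: T == 0 by rewrite scaler_nat mulr2n {1}TN addNr.
by rewrite scaler_eq0 pnatr_eq0.
Qed.

Section Tableau.
Variables (n : nat).

Definition fibre_stab (f : 'I_n -> nat) : {set 'S_n} :=
  [set s : 'S_n | [forall i, f (s i) == f i]].

Lemma fibre_stabP f (s : 'S_n) :
  reflect (forall i, f (s i) = f i) (s \in fibre_stab f).
Proof. by rewrite inE; apply: (iffP forallP) => H i; apply/eqP; have := H i. Qed.

Lemma fixer_fibre_stab f :
  'C(~: [set i | f i == 0%N] | 'P)%g \subset fibre_stab f.
Proof.
apply/subsetP => s /fixesP sD; apply/fibre_stabP => i.
have [fi0|fi0] := eqVneq (f i) 0%N; last by rewrite sD // !inE.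
rewrite fi0; apply/eqP; apply/negPn/negP => si.
have /perm_inj E : s (s i) = s i by apply: sD; rewrite !inE.
by rewrite E fi0 in si.
Qed.

Lemma pigeonhole_fibre (f : 'I_n -> nat) (b : nat) (B : {set 'I_n}) :
  (forall i, (f i < b)%N) -> (b < #|B|)%N ->
  exists i j, [/\ i \in B, j \in B, i != j & f i = f j].
Proof.
move=> fb bB; pose f' i : 'I_b := Ordinal (fb i).
have : ~~ dinjectiveb f' (mem B).
  apply: contraL bB => /dinjectiveP f'inj; rewrite -leqNgt.
  rewrite -[X in (_ <= X)%N]card_ord -(card_in_imset f'inj).
  exact: max_card.
case/dinjectivePn => i iB [j /andP[ji jB] /(congr1 val) /= fij].
by exists i, j; split=> //; rewrite eq_sym.
Qed.

(** More than b letters lie outside D, so two of them, moved by the inverse of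
    g, have the same f-value: their transposition t fixes D pointwise while its
    conjugate t' preserves f. *)
Lemma fixer_fibre_transposition (f : 'I_n -> nat) (b : nat) (D : {set 'I_n}) (g : 'S_n) :
  (forall i, (f i < b)%N) -> (#|D| < n - b)%N ->
  exists t t' : 'S_n, [/\ t \in 'C(D | 'P)%g, (t' * g * t = g)%g, odd_perm t, odd_perm t'
    & forall q, ((q * t')%g \in fibre_stab f) = (q \in fibre_stab f)].
Proof.
move=> fb Db; have bB : (b < #|~: D|)%N.
  by rewrite cardsCs setCK card_ord; lia.
have [i [j [iD jD ij fij]]] := @pigeonhole_fibre (fun i => f (g^-1%g i)) b _
  (fun i => fb _) bB.
rewrite !inE in iD jD.
exists (tperm i j), (tperm i j ^ g^-1)%g; split; rewrite ?odd_permJ ?odd_tperm ?ij //.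
- by apply/fixesP => k kD; rewrite tpermD //; [move: iD|move: jD];
    apply: contraNneq => ->.
- by rewrite conjgE invgK mulgA mulgKV -mulgA tperm2 mulg1.
move=> q; rewrite tpermJ.
have E k : f (tperm (g^-1%g i) (g^-1%g j) k) = f k.
  by case: tpermP => // ->.
by apply/fibre_stabP/fibre_stabP => H k; have := H k; rewrite permM E.
Qed.

End Tableau.

Section Specht.
Variables (F : numFieldType) (n : nat) (la : seq nat).
Hypothesis laP : is_partition n la.

Let row_of (i : 'I_n) := reshape_index la i.
Let col_of (i : 'I_n) := reshape_offset la i.

Lemma row_stabE : row_stab n la = fibre_stab row_of. Proof. by []. Qed.
Lemma column_stabE : column_stab n la = fibre_stab col_of. Proof. by []. Qed.

Lemma lt_sumn (i : 'I_n) : (i < sumn la)%N.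
Proof. by case/and3P: laP => _ _ /eqP ->. Qed.

Lemma row_of_lt i : (row_of i < size la)%N.
Proof. exact/reshape_indexP/lt_sumn. Qed.

Lemma col_of_lt i : (col_of i < head 0%N la)%N.
Proof.
apply: leq_trans (reshape_offsetP (lt_sumn i)) _.
have := row_of_lt i; rewrite /row_of; move: (reshape_index la i) => r.
case/and3P: laP => + _ _; case: la => //= x s.
rewrite path_sortedE => [/andP[/allP xs _]|]; last by move=> a b c /= ab /leq_trans; apply.
by case: r => // r rs; apply: (xs _ (mem_nth 0%N rs)).
Qed.

Lemma row_column_stab (s : 'S_n) :
  s \in row_stab n la -> s \in column_stab n la -> s = 1%g.
Proof.
move=> /fibre_stabP sr /fibre_stabP sc; apply/permP => i; rewrite perm1.
apply: ord_inj; rewrite -[LHS](reshape_indexK la) -[RHS](reshape_indexK la).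
by have := sr i; have := sc i; rewrite /row_of /col_of => -> ->.
Qed.

Lemma card_first_row : (#|~: [set i | row_of i == 0%N]| <= n - head 0%N la)%N.
Proof.
rewrite cardsCs setCK card_ord; apply: leq_sub2l.
have h0 : (head 0 la <= n)%N.
  case/and3P: laP => _ _ /eqP <-; case: la => //= x s; exact: leq_addr.
rewrite -[X in (X <= _)%N]card_ord -(card_imset _ (@widen_ord_inj _ _ h0)).
apply: subset_leq_card; apply/subsetP => _ /imsetP[k _ ->]; rewrite inE /row_of /=.
have := @flatten_indexKl la 0 k; rewrite /flatten_index take0 add0n nth0 => -> //.
Qed.

Lemma card_first_column : (#|~: [set i | col_of i == 0%N]| <= n - size la)%N.
Proof.
rewrite cardsCs setCK card_ord; apply: leq_sub2l.
have [_ /allP pos /eqP sn] := and3P laP.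
have nth0 (r : 'I_(size la)) : (0 < nth 0%N la r)%N by apply: pos; rewrite mem_nth.
have lt0 (r : 'I_(size la)) : (flatten_index la r 0 < n)%N.
  by rewrite -sn flatten_indexP.
pose c r := Ordinal (lt0 r).
have c_inj : injective c.
  move=> r s /(congr1 (fun i : 'I_n => reshape_index la i)) /=.
  by rewrite !flatten_indexKl // => /ord_inj.
rewrite -[X in (X <= _)%N]card_ord -(card_imset _ c_inj).
apply: subset_leq_card; apply/subsetP => _ /imsetP[r _ ->]; rewrite inE /col_of /=.
by rewrite flatten_indexKr.
Qed.

Local Notation aG := (regular_repr F [set: 'S_n]%G).
Local Notation e x :=
  (delta_mx 0 (gring_index [set: 'S_n]%G x) : 'rV[F]_#|[set: 'S_n]%G|).
Local Notation y := (young_symmetrizer F n la).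

Lemma young_mul z : y *m aG z =
  \sum_(p in row_stab n la) \sum_(q in column_stab n la)
    (-1) ^+ odd_perm q *: e (p * q * z)%g.
Proof.
rewrite /young_symmetrizer mulmx_suml; apply: eq_bigr => p _.
rewrite mulmx_suml; apply: eq_bigr => q _.
by rewrite -scalemxAl delta_regular.
Qed.

(** The coefficient of the identity is a sum of nonnegative integers among
    which the term p = q = h = 1 is positive. *)
Lemma specht_sum_neq0 (psi : 'S_n -> F) (H : {group 'S_n}) : psi 1%g = 1 ->
  (forall p q h, p \in row_stab n la -> q \in column_stab n la -> h \in H ->
     (p * q * h = 1)%g -> (-1) ^+ odd_perm q * psi h = 1) ->
  \sum_(h in H) psi h *: specht_repr F n la h != 0.
Proof.
move=> psi1 pqh; apply: cyclic_sum_neq0.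
apply/eqP => /rowP/(_ (gring_index [set: 'S_n]%G 1%g)) /eqP.
rewrite mxE summxE; apply/negP.
have -> : \sum_(h in H) (psi h *: (y *m aG h)) 0 (gring_index [set: 'S_n]%G 1%g) =
   \sum_(h in H) \sum_(p in row_stab n la) \sum_(q in column_stab n la)
     (p * q * h == 1)%g%:R.
  apply: eq_bigr => h Hh; rewrite young_mul mxE summxE mulr_sumr.
  apply: eq_bigr => p Rp; rewrite summxE mulr_sumr; apply: eq_bigr => q Cq.
  rewrite !mxE eqxx /= (can_in_eq (@gring_indexK _ _)) ?inE // eq_sym.
  have [/pqh E|_] := eqVneq (p * q * h)%g 1%g; last by rewrite !mulr0.
  by rewrite mulr1 mulrC E.
have S1 f : 1%g \in fibre_stab (f : 'I_n -> nat) by apply/fibre_stabP => i; rewrite perm1.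
have ge0 h : 0 <= \sum_(p in row_stab n la) \sum_(q in column_stab n la)
     (p * q * h == 1)%g%:R :> F.
  by apply: sumr_ge0 => p _; apply: sumr_ge0 => q _; rewrite ler0n.
rewrite gt_eqF // (bigD1 1%g) ?group1 //= ltr_pwDl ?sumr_ge0 //.
rewrite (bigD1 1%g) ?row_stabE ?S1 //= ltr_pwDl //; last first.
  by apply: sumr_ge0 => p _; apply: sumr_ge0 => q _; rewrite ler0n.
rewrite (bigD1 1%g) ?column_stabE ?S1 //= ltr_pwDl //; last first.
  by apply: sumr_ge0 => p _; rewrite ler0n.
by rewrite !mulg1 eqxx.
Qed.

(** Fewer than n - lambda_1 letters in D leave more than lambda_1 letters
    outside D, and there are only lambda_1 columns. *)
Lemma row_specht_sum0 (D : {set 'I_n}) : (#|D| < n - head 0%N la)%N ->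
  \sum_(h in 'C(D | 'P)%g) 1 *: specht_repr F n la h = 0.
Proof.
move=> cD; apply: (@cyclic_sum0 _ _ _ (fun=> 1)) => g.
under eq_bigr => h _ do rewrite scale1r young_mul.
rewrite exchange_big big1 // => p _ /=; rewrite exchange_big /=.
have [t [t' [Ht tgt _ ot' tC]]] := fixer_fibre_transposition g col_of_lt cD.
under eq_bigr => q _ do under eq_bigr => h _ do rewrite -!mulgA (mulgA q).
apply: (@sign_cancel _ _ _ _ _ (fun q h => (-1) ^+ odd_perm q) (fun x => e (p * x)%g))
  Ht tC tgt _ => q h.
by rewrite odd_permM ot' addbT signrN.
Qed.

(** The same argument for the rows; the sum over the column stabiliser is only
    translated here, so the element q is fixed and merged into g. *)
Lemma column_specht_sum0 (D : {set 'I_n}) : (#|D| < n - size la)%N ->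
  \sum_(h in 'C(D | 'P)%g) (-1) ^+ odd_perm h *: specht_repr F n la h = 0.
Proof.
move=> cD; apply: (@cyclic_sum0 _ _ _ (fun h => (-1) ^+ odd_perm h)) => g.
under eq_bigr => h _ do (rewrite young_mul exchange_big scaler_sumr /=).
rewrite exchange_big big1 // => q _ /=.
under eq_bigr => h _ do rewrite scaler_sumr.
rewrite exchange_big /=.
have [t [t' [Ht tgt ot _ tC]]] := fixer_fibre_transposition (q * g)%g row_of_lt cD.
under eq_bigr => p _ do under eq_bigr => h _ do
  rewrite scalerA -(mulgA p) (mulgA q) (mulgA p).
apply: (@sign_cancel _ _ _ _ _ (fun p h => (-1) ^+ odd_perm h * (-1) ^+ odd_perm q) (fun x => e x))
  Ht tC tgt _ => p h.
by rewrite odd_permM ot addTb signrN mulNr.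
Qed.

(** Permutations of the first row lie in the row stabiliser, which meets the
    column stabiliser trivially. *)
Lemma row_specht_sum_neq0 :
  \sum_(h in 'C(~: [set i | row_of i == 0%N] | 'P)%g) 1 *: specht_repr F n la h != 0.
Proof.
apply: (@specht_sum_neq0 (fun=> 1)) => // p q h Rp Cq Hh pqh.
have /fibre_stabP Rh := subsetP (fixer_fibre_stab row_of) _ Hh.
suff -> : q = 1%g by rewrite odd_perm1 expr0 mulr1.
apply: row_column_stab => //; apply/fibre_stabP => i.
move/fibre_stabP: Rp => Rp.
have hq : h (q i) = (p^-1)%g i.
  by rewrite -[RHS](perm1) -pqh !permM permKV.
by rewrite -[LHS]Rh hq -[LHS]Rp permKV.
Qed.

Lemma column_specht_sum_neq0 :
  \sum_(h in 'C(~: [set i | col_of i == 0%N] | 'P)%g)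
    (-1) ^+ odd_perm h *: specht_repr F n la h != 0.
Proof.
apply: (@specht_sum_neq0 (fun h => (-1) ^+ odd_perm h)) => [|p q h Rp Cq Hh pqh].
  by rewrite odd_perm1.
have /fibre_stabP Ch := subsetP (fixer_fibre_stab col_of) _ Hh.
have p1 : p = 1%g.
  apply: row_column_stab => //; apply/fibre_stabP => i.
  move/fibre_stabP: Cq => Cq.
  have hqp : h (q (p i)) = i by rewrite -!permM mulgA pqh perm1.
  by rewrite -[LHS]Cq -[LHS]Ch hqp.
by move: pqh; rewrite p1 mul1g -signr_addb -odd_permM => ->; rewrite odd_perm1.
Qed.

End Specht.

(** * Character values at a given level *)

Section Level.
Variables (F : numClosedFieldType) (n m : nat).
Variable rG : mx_representation F [set: 'S_n] m.
Hypothesis irr : mx_irreducible rG.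
Variable la : seq nat.
Hypothesis laP : is_partition n la.
Hypothesis rG_la : forall s, \tr (rG s) = specht_char F la s.

(** Since a D of size at most d has invariants while those of size below d have
    none, the former has size exactly d. *)
Lemma twisted_char_decay (psi : 'S_n -> F) (d : nat) (s : 'S_n) :
  psi 1%g = 1 -> {morph psi : x y / (x * y)%g >-> x * y} -> `|psi s| = 1 ->
  (2 * d < n)%N ->
  (forall D : {set 'I_n}, (#|D| < d)%N ->
     \sum_(h in 'C(D | 'P)%g) psi h *: specht_repr F n la h = 0) ->
  (exists2 D : {set 'I_n}, (#|D| <= d)%N &
     \sum_(h in 'C(D | 'P)%g) psi h *: specht_repr F n la h != 0) ->
  `|\tr (rG s)| * 'C(n, d)%:R <= \tr (rG 1%g) *
    \sum_(D : {set 'I_n} | #|D| == d)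
      (d%:R / (n - 2 * d)%:R) ^+ #|(s @: D) :\: D|.
Proof.
move=> psi1 psiM psis dn S0 [D cD SD].
pose rG' := twist_repr rG psi1 psiM; pose sp := twist_repr (specht_repr F n la) psi1 psiM.
have tr' h : \tr (rG' h) = \tr (sp h).
  by rewrite /= /twist_mx !mxtraceZ rG_la.
have iff0 A : (subgroup_sum rG' 'C(A | 'P)%g == 0) =
    (\sum_(h in 'C(A | 'P)%g) psi h *: specht_repr F n la h == 0).
  rewrite -[X in _ = (X == 0)]/(subgroup_sum sp 'C(A | 'P)%g) !subgroup_sum_eq0.
  by under eq_bigr => h _ do rewrite tr'.
have -> : `|\tr (rG s)| = `|\tr (rG' s)| by rewrite /= /twist_mx mxtraceZ normrM psis mul1r.
have -> : \tr (rG 1%g) = \tr (rG' 1%g) by rewrite !repr_mx1.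
apply: char_decay => //; first exact: twist_irreducible.
  by move=> A cA; apply/eqP; rewrite iff0 S0.
exists D; last by rewrite iff0.
apply/eqP; rewrite eqn_leq cD leqNgt; apply: contra SD => /S0 ->.
by [].
Qed.

Lemma level_char_decay (s : 'S_n) (d := partition_level n la) :
  (2 * d < n)%N ->
  `|\tr (rG s)| * 'C(n, d)%:R <= \tr (rG 1%g) *
    \sum_(D : {set 'I_n} | #|D| == d)
      (d%:R / (n - 2 * d)%:R) ^+ #|(s @: D) :\: D|.
Proof.
rewrite /d /partition_level /minn; case: ifP => _ dn.
  apply: (@twisted_char_decay (fun=> 1)) => //.
  - by move=> x y /=; rewrite mulr1.
  - by rewrite normr1.
  - exact: row_specht_sum0.
  by eexists; [exact: card_first_row|exact: row_specht_sum_neq0].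
apply: (@twisted_char_decay (fun h => (-1) ^+ odd_perm h)) => //.
- by rewrite odd_perm1.
- by move=> x y /=; rewrite odd_permM signr_addb.
- by rewrite normrX normrN1 expr1n.
- exact: column_specht_sum0.
by eexists; [exact: card_first_column|exact: column_specht_sum_neq0].
Qed.

End Level.

(** * Counting sets by their boundary *)

Lemma ler_sum_inj (R : numDomainType) (I J : finType) (A : {pred I}) (B : {pred J})
    (f : I -> J) (G : J -> R) :
  {in A &, injective f} -> {in A, forall i, f i \in B} -> {in B, forall j, 0 <= G j} ->
  \sum_(i in A) G (f i) <= \sum_(j in B) G j.
Proof.
move=> f_inj fAB G0; rewrite -(big_imset G f_inj) /=.
rewrite big_mkcond [leRHS]big_mkcond; apply: ler_sum => j _.
case: ifP => [/imsetP[i iA ->]|_]; first by rewrite fAB.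
by case: ifP => // /G0.
Qed.

Section Runs.
Variables (n : nat) (s : 'S_n).
Implicit Types (D : {set 'I_n}) (x y e : 'I_n).

Definition bounded_invariant_sets (d : nat) : {set {set 'I_n}} :=
  [set K : {set 'I_n} | (s @: K == K) && (#|K| <= d)%N].

Definition core D : {set 'I_n} := [set x | porbit s x \subset D].

(** For e outside D this is the number of consecutive preimages of e under s
    that lie in D, and it is set to 0 on D; at most n preimages need be inspected.
    Every longest segment of D along a cycle not contained in D ends just before
    a unique e. *)
Definition run D e : nat :=
  if e \in D then 0 else find (fun i => iter i.+1 s^-1%g e \notin D) (iota 0 n).

Lemma iterVK i j x : (i <= j)%N -> iter i s^-1%g (iter j s x) = iter (j - i) s x.
Proof.
elim: i => [|i IH] ij; first by rewrite subn0.
by rewrite iterS IH ?(ltnW ij) // -[(j - i)%N]subnSK // iterS permK.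
Qed.

Lemma run_le D e : (run D e <= n)%N.
Proof. by rewrite /run; case: ifP => // _; rewrite -[leqRHS](size_iota 0) find_size. Qed.

Lemma run_mem D e i : (i < run D e)%N -> iter i.+1 s^-1%g e \in D.
Proof.
rewrite /run; case: ifP => // _ ir; have := before_find 0%N ir.
have iln : (i < n)%N.
  by apply: leq_trans ir _; apply: leq_trans (find_size _ _) _; rewrite size_iota.
by rewrite nth_iota // add0n => /negbFE.
Qed.

Lemma run_ge D e k : e \notin D -> (k <= n)%N ->
  (forall i, (i < k)%N -> iter i.+1 s^-1%g e \in D) -> (k <= run D e)%N.
Proof.
move=> eD kn H; rewrite /run (negbTE eD) leqNgt; apply/negP => lt.
set a := fun _ => _ in lt.
have rn : (find a (iota 0 n) < n)%N := leq_trans lt kn.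
have ha : has a (iota 0 n) by rewrite has_find size_iota.
by have := nth_find 0%N ha; rewrite nth_iota // add0n /a H.
Qed.

Lemma core_invariant D d : #|D| = d -> core D \in bounded_invariant_sets d.
Proof.
move=> cD; rewrite inE; apply/andP; split; last first.
  rewrite -cD subset_leq_card //; apply/subsetP => x; rewrite inE => /subsetP; apply.
  exact: porbit_id.
rewrite eqEcard card_imset ?leqnn ?andbT; last exact: perm_inj.
apply/subsetP => _ /imsetP[x + ->]; rewrite !inE.
suff -> : porbit s (s x) = porbit s x by [].
by apply/eqP; rewrite eq_porbit_mem; have := mem_porbit s 1 x; rewrite expg1.
Qed.

Lemma run_gt0 D e : (0 < run D e)%N = (e \in (s @: D) :\: D).
Proof.
rewrite inE; apply/idP/andP => [r0|[eD /imsetP[x xD ex]]]; last first.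
  subst e; apply: run_ge => // [|[]// _]; last by rewrite /= permK.
  exact: leq_ltn_trans (ltn_ord x).
split; first by move: r0; rewrite /run; case: ifP.
by have /= sD := run_mem r0; rewrite -[e](permKV s) imset_f.
Qed.

(** A letter of D outside the core reaches the complement of D along its cycle;
    the first exit point e carries a run that contains the letter. *)
Lemma mem_run D x : (x \in D) =
  (x \in core D) || [exists e, [exists i : 'I_n, (i < run D e)%N && (iter i.+1 s^-1%g e == x)]].
Proof.
apply/idP/orP => [xD|[|/existsP[e /existsP[i /andP[ir /eqP <-]]]]]; last 2 first.
- by rewrite inE => /subsetP; apply; apply: porbit_id.
- exact: run_mem.
have [|xK] := boolP (x \in core D); [by left|right].
have ex : exists k, iter k s x \notin D.
  move: xK; rewrite inE => /subsetPn[y /porbitP[k ->] yD].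
  by exists k; rewrite -permX.
have kn : (ex_minn ex < n)%N.
  case: ex_minnP => k _ kmin; move: xK; rewrite inE => /subsetPn[y + yD].
  rewrite porbit_traject => /trajectP[j jlt yj].
  apply: leq_ltn_trans (leq_trans jlt _); first by apply: kmin; rewrite -yj.
  by apply: leq_trans (max_card _) _; rewrite card_ord.
move: kn; case: ex_minnP => -[|k] kD kmin kn; first by rewrite /= xD in kD.
apply/existsP; exists (iter k.+1 s x); apply/existsP; exists (Ordinal (ltnW kn)).
apply/andP; split; last by rewrite (iterVK x (leqnn k.+1)) subnn.
apply: run_ge => // i ik.
rewrite iterVK //; apply/negPn/negP => /kmin.
by rewrite subSS ltnNge leq_subr.
Qed.

Lemma run_inj D1 D2 : core D1 = core D2 -> run D1 =1 run D2 -> D1 = D2.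
Proof.
move=> K r; apply/setP => x; rewrite [LHS]mem_run [RHS]mem_run K; congr (_ || _).
by apply: eq_existsb => e; apply: eq_existsb => i; rewrite r.
Qed.

(** Distinct runs are disjoint: a common letter lies nearer to the end point of one
    run than to that of the other, which places the nearer end point, a letter
    outside D, inside the other run. *)
Lemma sum_run D : (\sum_e run D e <= #|D|)%N.
Proof.
have -> : (\sum_e run D e = #|[pred u : 'I_n * 'I_n | u.2 < run D u.1]|)%N.
  rewrite -sum1_card -[RHS](pair_big_dep xpredT
    (fun e (i : 'I_n) => (i < run D e)%N) (fun _ _ => 1%N)) /=.
  apply: eq_bigr => e _; rewrite sum1_card.
  rewrite -[LHS]card_ord
    -(card_imset predT (@widen_ord_inj _ _ (run_le D e))); apply: eq_card => i.
  apply/imsetP/idP => [[k _ ->]|ir]; first exact: (ltn_ord k).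
  by exists (Ordinal ir) => //; apply: val_inj.
pose f (u : 'I_n * 'I_n) := iter u.2.+1 s^-1%g u.1.
rewrite -(card_in_imset (f := f)).
  apply: subset_leq_card; apply/subsetP => _ /imsetP[u uR ->].
  exact: run_mem uR.
have iterV_inj k : injective (iter k (s^-1)%g).
  by elim: k => // k IH x y /= /perm_inj /IH.
have key e1 e2 (i1 i2 : nat) : (i1 < i2)%N -> (i1 < run D e1)%N -> (i2 < run D e2)%N ->
    iter i1.+1 s^-1%g e1 = iter i2.+1 s^-1%g e2 -> False.
  move=> ii r1 r2; have -> : i2.+1 = (i1.+1 + (i2 - i1.+1).+1)%N by lia.
  rewrite iterD => /iterV_inj e1E.
  have : e1 \in D.
    by rewrite e1E; apply: run_mem; apply: leq_ltn_trans r2; lia.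
  by move: r1; rewrite /run; case: ifP.
move=> [e1 i1] [e2 i2]; rewrite !inE /= => r1 r2 E.
case: (ltngtP i1 i2) => [lt|lt|eqi].
- by case: (key _ _ _ _ lt r1 r2).
- by case: (key _ _ _ _ lt r2 r1).
by move: E; rewrite /f /= eqi => /perm_inj/iterV_inj ->; congr (_, _); apply: ord_inj.
Qed.

(** A set is encoded by its core and its run lengths, whose support is the
    boundary.  As the run lengths sum to at most d, the product of the weights
    2 ^ -l is at least 2 ^ -d, and the sum of all weights factors over the letters
    into geometric series. *)
Lemma boundary_sum (R : numFieldType) (t : R) (d : nat) : 0 <= t ->
  \sum_(D : {set 'I_n} | #|D| == d) t ^+ #|(s @: D) :\: D| <=
  #|bounded_invariant_sets d|%:R * (2 ^+ d * (1 + t) ^+ n).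
Proof.
move=> t0.
pose w (k : nat) : R := if k == 0%N then 1 else t / 2 ^+ k.
have w0 k : 0 <= w k by rewrite /w; case: ifP => // _; rewrite divr_ge0 ?exprn_ge0.
pose code D : {set 'I_n} * {ffun 'I_n -> 'I_n.+1} :=
  (core D, [ffun e => inord (run D e)]).
have codeE D e : (code D).2 e = run D e :> nat.
  by rewrite ffunE inordK // ltnS run_le.
pose G (z : {set 'I_n} * {ffun 'I_n -> 'I_n.+1}) := 2 ^+ d * \prod_e w (z.2 e).
have G0 z : 0 <= G z by rewrite mulr_ge0 ?exprn_ge0 ?prodr_ge0.
apply: le_trans (_ : \sum_(D : {set 'I_n} | #|D| == d) G (code D) <= _).
  apply: ler_sum => D /eqP cD.
  have -> : t ^+ #|(s @: D) :\: D| = \prod_e (if (0 < run D e)%N then t else 1).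
    by rewrite -big_mkcond -prodr_const; apply: eq_bigl => e; rewrite run_gt0.
  have -> : G (code D) = 2 ^+ d * \prod_e (2 ^+ run D e)^-1 *
      \prod_e (if (0 < run D e)%N then t else 1).
    rewrite /G -mulrA -big_split /=; congr (_ * _); apply: eq_bigr => e _.
    by rewrite codeE /w lt0n; case: eqP => [->|_] /=; rewrite ?invr1 ?mulr1 // mulrC.
  rewrite ler_peMl ?prodr_ge0 // => [e _|]; first by case: ifP.
  rewrite prodfV -expr_sum ler_pdivlMr ?mul1r ?exprn_gt0 //.
  by rewrite ler_weXn2l ?ler1n // -cD sum_run.
apply: le_trans (ler_sum_inj (B := [pred z | z.1 \in bounded_invariant_sets d]) _ _ _) _.
- move=> D1 D2 _ _ E; apply: run_inj => [|e]; first by have := congr1 fst E.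
  by rewrite -!codeE E.
- by move=> D /eqP cD; rewrite inE /= core_invariant.
- by move=> z _; exact: G0.
rewrite (eq_bigl (fun z : {set 'I_n} * _ => (z.1 \in bounded_invariant_sets d) && true));
  last by move=> z; rewrite inE andbT.
rewrite -(pair_big (mem (bounded_invariant_sets d)) xpredT
   (fun (_ : {set 'I_n}) (l : {ffun 'I_n -> 'I_n.+1}) => 2 ^+ d * \prod_e w (l e))) /=.
rewrite sumr_const -[leLHS]mulr_natl ler_wpM2l // -mulr_sumr ler_wpM2l ?exprn_ge0 //.
rewrite -(bigA_distr_bigA (fun (e : 'I_n) (k : 'I_n.+1) => w k)) /=.
rewrite prodr_const card_ord lerXn2r ?nnegrE ?sumr_ge0 ?addr_ge0 //.
rewrite big_ord_recl /= {1}/w eqxx lerD2l.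
suff -> : \sum_(i < n) w (bump 0 i) = t * (1 - (2 ^+ n)^-1).
  by rewrite ler_piMr // gerBl invr_ge0 exprn_ge0.
elim: n => [|k IH]; first by rewrite big_ord0 expr0 invr1 subrr mulr0.
rewrite big_ord_recr /= IH /w /= /bump /= add1n exprS; field.
by rewrite expf_neq0 // pnatr_eq0.
Qed.

End Runs.

(** * Moments of the number of small invariant sets *)

Section Burnside.
Variables (n Q : nat).

(** A Q-tuple of subsets of the letters, written as the map that sends a letter
    to the set of indices of the subsets containing it. *)
Definition colouring := {ffun 'I_n -> {set 'I_Q}}.

Definition permute (g : colouring) (s : 'S_n) : colouring := [ffun i => g (s^-1%g i)].

Lemma permute_is_action : is_action [set: 'S_n] permute.
Proof.
apply: is_total_action => [g|g s t]; apply/ffunP => i; rewrite !ffunE.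
  by rewrite invg1 perm1.
by rewrite invMg permM.
Qed.

Canonical permute_action := Action permute_is_action.

Definition small_colourings (d : nat) : {set colouring} :=
  [set g : colouring | [forall q, (#|[set i | q \in g i]| <= d)%N]].

Lemma acts_small_colourings d :
  [acts [set: 'S_n], on small_colourings d | permute_action].
Proof.
apply/actsP => s _ g; rewrite !inE; apply: eq_forallb => q; congr (_ <= _)%N.
rewrite -(card_imset _ (@perm_inj _ (s^-1)%g)); apply: eq_card => i.
rewrite inE -[i in LHS](permK s) mem_imset; last exact: perm_inj.
by rewrite inE ffunE permK.
Qed.

Lemma bounded_invariant_sets_exp (s : 'S_n) d :
  (#|bounded_invariant_sets s d| ^ Q <=
   #|'Fix_(small_colourings d | permute_action)[s]%g|)%N.
Proof.
rewrite -[X in (_ ^ X)%N](card_ord Q) -card_ffun_on.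
pose f (k : {ffun 'I_Q -> {set 'I_n}}) : colouring := [ffun i => [set q | i \in k q]].
have f_inj : injective f.
  move=> k1 k2 /ffunP k12; apply/ffunP => q; apply/setP => i.
  by have /setP/(_ q) := k12 i; rewrite !ffunE !inE.
rewrite -(card_imset _ f_inj); apply: subset_leq_card.
apply/subsetP => _ /imsetP[k /ffun_onP kP ->]; rewrite inE; apply/andP; split.
  rewrite inE; apply/forallP => q.
  have -> : [set i | q \in f k i] = k q by apply/setP => i; rewrite !inE ffunE inE.
  by have := kP q; rewrite inE => /andP[].
apply/afix1P; apply/ffunP => i; rewrite !ffunE; apply/setP => q; rewrite !inE.
have := kP q; rewrite inE => /andP[/eqP sk _].
by rewrite -[in RHS]sk -[i in RHS](permKV s) mem_imset //; apply: perm_inj.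
Qed.

(** The fibre over the empty set is left out: its size is determined by the
    others, and it would not be controlled by any weight. *)
Definition fibre_sizes (g : colouring) : {ffun {set 'I_Q} -> 'I_n.+1} :=
  [ffun v => if v == set0 then ord0 else inord #|[set i | g i == v]|].

Lemma fibre_sizesE g v : v != set0 -> fibre_sizes g v = #|[set i | g i == v]| :> nat.
Proof.
move=> v0; rewrite ffunE (negbTE v0) inordK // ltnS.
by apply: leq_trans (max_card _) _; rewrite card_ord.
Qed.

Lemma sum_fibres (A : finType) (g : 'I_n -> A) : (\sum_v #|[set i | g i == v]| = n)%N.
Proof.
rewrite -[RHS]card_ord -sum1_card (partition_big g xpredT) //=.
by apply: eq_bigr => v _; rewrite -sum1_card; apply: eq_bigl => i; rewrite inE.
Qed.

Lemma fibre_sizes_orbit (g1 g2 : colouring) : fibre_sizes g1 = fibre_sizes g2 ->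
  orbit permute_action [set: 'S_n] g1 = orbit permute_action [set: 'S_n] g2.
Proof.
move=> E; have E0 v : v != set0 -> #|[set i | g1 i == v]| = #|[set i | g2 i == v]|.
  by move=> v0; rewrite -!fibre_sizesE // E.
have [s sP] : exists s : 'S_n, forall i, g1 i = g2 (s i).
  apply: same_fibres_perm => v; have [->|/E0//] := eqVneq v set0.
  have := sum_fibres g1; rewrite -[X in _ = X -> _](sum_fibres g2).
  rewrite (bigD1 set0) //= [in RHS](bigD1 set0) //= (eq_bigr _ E0).
  exact: addIn.
apply/esym/orbit_eqP; apply/orbitP; exists s; rewrite ?inE //.
by apply/ffunP => i; rewrite ffunE sP permKV.
Qed.

Lemma fibre_sizes_weight d g : g \in small_colourings d ->
  (\sum_v #|(v : {set 'I_Q})| * fibre_sizes g v <= Q * d)%N.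
Proof.
rewrite inE => /forallP gd.
have -> : (\sum_v #|(v : {set 'I_Q})| * fibre_sizes g v = \sum_i #|g i|)%N.
  rewrite [RHS](partition_big g xpredT) //=; apply: eq_bigr => v _.
  have [->|v0] := eqVneq v set0.
    by rewrite cards0 mul0n big1 // => i /eqP ->; rewrite cards0.
  rewrite fibre_sizesE // mulnC -sum_nat_const; apply: eq_big => [i|i]; rewrite inE //.
  by move/eqP->.
have -> : (\sum_i #|g i| = \sum_q #|[set i | q \in g i]|)%N.
  under eq_bigr => i _ do rewrite -sum1_card big_mkcond.
  under [RHS]eq_bigr => q _ do rewrite -sum1_card big_mkcond.
  rewrite exchange_big; apply: eq_bigr => q _; apply: eq_bigr => i _.
  by rewrite inE.
by apply: leq_trans (leq_sum _ (fun q _ => gd q)) _; rewrite sum_nat_const card_ord.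
Qed.

Lemma card_orbits_le (d : nat) :
  (#|orbit permute_action [set: 'S_n] @: small_colourings d| <=
   #|fibre_sizes @: small_colourings d|)%N.
Proof.
set S := small_colourings d.
have -> : orbit permute_action [set: 'S_n] @: S =
   (fun u => odflt set0 (omap (orbit permute_action [set: 'S_n])
       [pick g in S | fibre_sizes g == u])) @: (fibre_sizes @: S).
  rewrite -imset_comp; apply: eq_in_imset => g gS /=.
  case: pickP => [g' /andP[_ /eqP/fibre_sizes_orbit E]|/(_ g)]; first exact: esym.
  by rewrite gS eqxx.
exact: leq_imset_card.
Qed.


(** Rankin's trick: the total weight of small colourings is at most Q d, so each
    of them is counted with weight at least x ^ (Q d) in a product of geometric
    series. *)
Lemma fibre_sizes_count (R : numFieldType) (x : R) d : 0 < x < 1 ->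
  #|fibre_sizes @: small_colourings d|%:R <=
  x ^- (Q * d) * \prod_(v : {set 'I_Q} | v != set0) (1 - x ^+ #|v|)^-1.
Proof.
case/andP=> x0 x1; have x0' := ltW x0; have x1' := ltW x1.
pose w (v : {set 'I_Q}) (k : nat) : R :=
  if v == set0 then (k == 0)%:R else (x ^+ #|v|) ^+ k.
have w0 v k : 0 <= w v k.
  by rewrite /w; case: ifP => _; rewrite ?ler0n // !exprn_ge0 //.
apply: le_trans (_ : \sum_(u in fibre_sizes @: small_colourings d)
    x ^- (Q * d) * \prod_v w v (u v) <= _).
  rewrite -sum1_card natr_sum; apply: ler_sum => _ /imsetP[g gS ->].
  have -> : \prod_v w v (fibre_sizes g v) = x ^+ (\sum_v #|(v : {set 'I_Q})| * fibre_sizes g v).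
    rewrite expr_sum; apply: eq_bigr => v _; rewrite /w.
    case: eqP => [->|_]; last by rewrite exprM.
    by rewrite cards0 mul0n ffunE eqxx.
  rewrite mulrC ler_pdivlMr ?exprn_gt0 // mul1r.
  by rewrite ler_wiXn2l // fibre_sizes_weight.
rewrite -mulr_sumr ler_wpM2l ?invr_ge0 ?exprn_ge0 //.
apply: le_trans (_ : \sum_(u : {ffun {set 'I_Q} -> 'I_n.+1}) \prod_v w v (u v) <= _).
  rewrite [leRHS](bigID [in fibre_sizes @: small_colourings d]) /= lerDl sumr_ge0 // => u _.
  exact: prodr_ge0.
rewrite -(bigA_distr_bigA (fun v (k : 'I_n.+1) => w v k)) /=.
rewrite (bigD1 set0) //= big_ord_recl {1}/w eqxx big1 ?addr0 ?mul1r; last first.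
  by move=> i _; rewrite /w eqxx.
apply: ler_prod => v v0; rewrite sumr_ge0 //=.
rewrite (eq_bigr (fun k : 'I_n.+1 => (x ^+ #|v|) ^+ k)); last by move=> k _; rewrite /w (negbTE v0).
have y1 : x ^+ #|v| < 1 by rewrite exprn_ilt1 // cards_eq0.
set y := x ^+ #|v| in y1 *; have y0 : 0 <= y by rewrite exprn_ge0 //.
have d0 : 0 < 1 - y by rewrite subr_gt0.
rewrite -[leRHS]mul1r ler_pdivlMr // mulrC.
have -> : (1 - y) * \sum_(k < n.+1) y ^+ k = 1 - y ^+ n.+1.
  by rewrite -opprB mulNr -subrX1 opprB.
by rewrite gerBl exprn_ge0.
Qed.

(** Burnside's count of orbits, since tuples of invariant sets are the
    colourings fixed by s. *)
Lemma invariant_sets_moment (R : numFieldType) (x : R) d : 0 < x < 1 ->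
  \sum_(s : 'S_n) #|bounded_invariant_sets s d|%:R ^+ Q <=
  n`!%:R * (x ^- (Q * d) * \prod_(v : {set 'I_Q} | v != set0) (1 - x ^+ #|v|)^-1).
Proof.
move=> x01; apply: le_trans (_ : n`!%:R * #|fibre_sizes @: small_colourings d|%:R <= _);
  last by rewrite ler_wpM2l // fibre_sizes_count.
under eq_bigr => s _ do rewrite -natrX.
rewrite -natr_sum -natrM ler_nat.
apply: leq_trans (leq_sum _ (fun s _ => bounded_invariant_sets_exp s d)) _.
have := Frobenius_Cauchy (acts_small_colourings d).
rewrite (eq_bigl xpredT); last by move=> s; rewrite inE.
move=> ->; rewrite cardsT card_Sn mulnC leq_mul2l card_orbits_le orbT //.
Qed.

End Burnside.

(** * Estimates on moments *)

Lemma leq_exp_bin (n d : nat) : (2 * d <= n)%N -> (n ^ d <= (2 * d) ^ d * 'C(n, d))%N.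
Proof.
move=> dn; rewrite expnMn -mulnA.
apply: leq_trans (_ : 2 ^ d * (d`! * 'C(n, d)) <= _)%N; last first.
  rewrite leq_mul2l leq_mul2r; apply/orP; right; apply/orP; right.
  elim: d {dn} => // d IH; rewrite factS expnS leq_mul //.
  by apply: leq_trans IH _; case: d => // d; rewrite leq_exp2r.
rewrite mulnA -mulnA [(d`! * _)%N]mulnC bin_ffact ffact_prod.
rewrite -[X in (n ^ X)%N]card_ord -[X in (2 ^ X)%N]card_ord -!prod_nat_const.
rewrite -big_split; apply: leq_prod => i _ /=; have := ltn_ord i; lia.
Qed.

Section Analysis.
Variable R : realType.

Lemma inv_subr_le_exp (y : R) : 0 <= y <= 1 / 2 -> (1 - y)^-1 <= expR (2 * y).
Proof.
case/andP=> y0 y1; apply: le_trans (expR_ge1Dx _).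
rewrite -[leLHS]mul1r ler_pdivrMr; nra.
Qed.

(** The sum of x ^ #|v| over all subsets v of a Q-set is (1 + x) ^ Q. *)
Lemma prod_inv_subr_le (Q : nat) (x : R) : 0 <= x <= 1 / 2 ->
  \prod_(v : {set 'I_Q} | v != set0) (1 - x ^+ #|v|)^-1 <= expR (2 * expR (x * Q%:R)).
Proof.
case/andP=> x0 x1.
have yP (v : {set 'I_Q}) : v != set0 -> 0 <= x ^+ #|v| <= 1 / 2.
  move=> v0; rewrite exprn_ge0 //=; apply: le_trans (x1).
  by rewrite -[leRHS]expr1 ler_wiXn2l ?card_gt0 //; lra.
apply: le_trans (_ : \prod_(v : {set 'I_Q} | v != set0) expR (2 * x ^+ #|v|) <= _).
  apply: ler_prod => v /yP yv; rewrite inv_subr_le_exp // andbT invr_ge0.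
  by move: yv; lra.
rewrite -expR_sum ler_expR -mulr_sumr ler_wpM2l //.
apply: le_trans (_ : \sum_(v : {set 'I_Q}) x ^+ #|v| <= _).
  by rewrite [leRHS](bigD1 set0) //= lerDr exprn_ge0.
have -> : \sum_(v : {set 'I_Q}) x ^+ #|v| = (1 + x) ^+ Q.
  rewrite -[in RHS](card_ord Q) -prodr_const addrC bigA_distr.
  apply: eq_bigr => v _; rewrite -prodr_const big_mkcond /=.
  by [].
by rewrite mulrC expRM_natl lerXn2r ?nnegrE ?expR_ge0 ?expR_ge1Dx //; lra.
Qed.

(** With x = ln Q / Q one has x ^ -d = (Q / ln Q) ^ d, while the product over
    nonempty subsets is at most exp (2 exp (x Q)) = exp (2 Q). *)
Lemma invariant_sets_log_moment (n d Q : nat) : (1 < Q)%N ->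
  \sum_(s : 'S_n) #|bounded_invariant_sets s d|%:R ^+ Q <=
  n`!%:R * (expR 2 * (Q%:R / ln Q%:R) ^+ d) ^+ Q :> R.
Proof.
move=> Q1; have Q1R : 1 < Q%:R :> R by rewrite ltr1n.
have l0 : 0 < ln Q%:R :> R by rewrite ln_gt0.
set x := ln Q%:R / Q%:R : R.
have x0 : 0 < x by rewrite divr_gt0 // (lt_trans _ Q1R).
have x1 : x <= 1 / 2.
  rewrite ler_pdivrMr ?(lt_trans _ Q1R) // -ler_expR lnK ?posrE ?(lt_trans _ Q1R) //.
  have := expR_ge1Dx (1 / 4 * Q%:R : R) => e1.
  have -> : 1 / 2 * Q%:R = 1 / 4 * Q%:R + 1 / 4 * Q%:R :> R by field.
  rewrite expRD; move: (expR _) e1 Q1R => e; move: (Q%:R : R) => q e1 q1.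
  (* q <= (1 + q / 4) ^ 2 because (1 - q / 4) ^ 2 is nonnegative. *)
  apply: le_trans (_ : (1 + 1 / 4 * q) * (1 + 1 / 4 * q) <= _); last first.
    by apply: ler_pM => //; lra.
  by have := sqr_ge0 (1 - 1 / 4 * q); rewrite expr2; lra.
apply: le_trans (@invariant_sets_moment n Q R x d _) _.
  by apply/andP; split => //; lra.
have -> : x ^- (Q * d) = ((Q%:R / ln Q%:R) ^+ d) ^+ Q :> R.
  by rewrite -exprM mulnC -exprVn invf_div.
rewrite [X in _ <= _ * X]exprMn ler_wpM2l // [leLHS]mulrC ler_wpM2r //.
  by rewrite !exprn_ge0 // divr_ge0 // ltW.
apply: le_trans (prod_inv_subr_le Q _) _; first by rewrite x1 ltW.
rewrite -expRM_natl ler_expR /x divfK ?gt_eqF ?(lt_trans _ Q1R) //.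
by rewrite lnK ?posrE ?(lt_trans _ Q1R) // mulrC.
Qed.

(** With Y = X / B, use Y <= 1 + Y ^ k and then Young's inequality for
    f * Y ^ k, the parameter a being chosen so that both resulting terms are at
    most half the sum of f. *)
Lemma weighted_sum_le (I : finType) (f X : I -> R) (k : nat) (M B E : R) :
  (forall i, 0 <= f i) -> (forall i, 0 <= X i) -> (0 < k)%N ->
  0 < M -> 0 < B -> 0 < \sum_i f i -> 0 < E ->
  E * \sum_i f i ^+ 2 <= (M * \sum_i f i) ^+ 2 ->
  M ^+ 2 * \sum_i X i ^+ (2 * k) <= E * B ^+ (2 * k) ->
  \sum_i f i * X i <= 2 * B * \sum_i f i.
Proof.
move=> f0 X0 k0 M0 B0 S0 E0; set S := \sum_i f i in S0 * => f2 X2.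
pose Y i := X i / B.
have Y0 i : 0 <= Y i by rewrite divr_ge0 // ltW.
have Y1 i : Y i <= 1 + Y i ^+ k.
  have [y1|y1] := leP (Y i) 1; first by rewrite (le_trans y1) // lerDl exprn_ge0.
  apply: le_trans (_ : Y i ^+ k <= _); last by rewrite lerDr.
  by rewrite -[leLHS]expr1 ler_weXn2l // ltW.
pose a := E / (M ^+ 2 * S).
have a0 : 0 < a by rewrite divr_gt0 ?mulr_gt0 ?exprn_gt0.
have fY i : f i * Y i ^+ k <= (a * f i ^+ 2 + Y i ^+ (2 * k) / a) / 2.
  rewrite mulnC exprM; set y := Y i ^+ k.
  have ya : y = (y / a) * a by rewrite divfK // gt_eqF.
  rewrite ler_pdivlMr // -subr_ge0.
  have -> : a * f i ^+ 2 + y ^+ 2 / a - f i * y * 2 = a * (f i - y / a) ^+ 2.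
    by field; rewrite gt_eqF.
  by rewrite mulr_ge0 ?sqr_ge0 // ltW.
have -> : \sum_i f i * X i = B * \sum_i f i * Y i.
  rewrite mulr_sumr; apply: eq_bigr => i _.
  by rewrite /Y mulrCA [B * _]mulrC divfK // gt_eqF.
rewrite [2 * B]mulrC -mulrA ler_pM2l //.
have S1 : a * \sum_i f i ^+ 2 <= S.
  rewrite /a mulrAC ler_pdivrMr ?mulr_gt0 ?exprn_gt0 //.
  by apply: le_trans f2 _; rewrite le_eqVlt; apply/orP; left; apply/eqP; ring.
have S2 : (\sum_i Y i ^+ (2 * k)) / a <= S.
  have -> : \sum_i Y i ^+ (2 * k) = (\sum_i X i ^+ (2 * k)) / B ^+ (2 * k).
    by rewrite mulr_suml; apply: eq_bigr => i _; rewrite /Y exprMn exprVn.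
  rewrite ler_pdivrMr // /a mulrCA -[S * _]mulrC invfM.
  rewrite ler_pdivrMr ?exprn_gt0 //.
  have -> : E * (M ^- 2 * S^-1 * S) = E / M ^+ 2 by rewrite divfK ?gt_eqF.
  by rewrite mulrAC ler_pdivlMr ?exprn_gt0 // mulrC.
apply: le_trans (_ : \sum_i (f i + (a * f i ^+ 2 + Y i ^+ (2 * k) / a) / 2) <= _).
  apply: ler_sum => i _; apply: le_trans (_ : f i * (1 + Y i ^+ k) <= _).
    by rewrite ler_wpM2l.
  by rewrite mulrDr mulr1 lerD2l.
rewrite big_split /= -mulr_suml big_split /= -mulr_sumr -mulr_suml -/S.
by move: S1 S2; lra.
Qed.

End Analysis.

(** * The level inequality *)

Section Final.
Variable R : realType.

(** For n >= 4 d one has n d / (n - 2 d) <= 2 d, so that the power on the left is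
    at most e ^ (2 d), and the binomial coefficient is at least (n / (2 d)) ^ d. *)
Lemma boundary_constant (n d : nat) : (0 < d)%N -> (4 * d <= n)%N ->
  2 ^+ d * (1 + d%:R / (n - 2 * d)%:R) ^+ n <=
  (4 * expR 2 * d%:R / n%:R) ^+ d * 'C(n, d)%:R :> R.
Proof.
move=> d0 dn; have n0 : 0 < n%:R :> R by rewrite ltr0n; lia.
have nd0 : 0 < (n - 2 * d)%:R :> R by rewrite ltr0n; lia.
have t0 : 0 <= d%:R / (n - 2 * d)%:R :> R by rewrite divr_ge0.
have e2 : (1 + d%:R / (n - 2 * d)%:R) ^+ n <= expR 2 ^+ d :> R.
  apply: le_trans (_ : expR (d%:R / (n - 2 * d)%:R) ^+ n <= _).
    by rewrite lerXn2r ?nnegrE ?expR_ge0 ?expR_ge1Dx // addr_ge0.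
  rewrite -!expRM_natl ler_expR mulrCA ler_wpM2l // ler_pdivrMr //.
  by rewrite -natrM ler_nat; lia.
have bin : n%:R ^+ d <= (2 * d%:R) ^+ d * 'C(n, d)%:R :> R.
  by rewrite -!(natrM, natrX) ler_nat leq_exp_bin //; lia.
apply: le_trans (_ : 2 ^+ d * expR 2 ^+ d <= _).
  by rewrite ler_wpM2l // exprn_ge0.
have -> : 4 * expR 2 * d%:R / n%:R = 2 * expR 2 * (2 * d%:R) / n%:R :> R by ring.
rewrite -exprMn expr_div_n [in leRHS]exprMn -!mulrA ler_peMr //.
  by rewrite exprn_ge0 // mulr_ge0 // expR_ge0.
by rewrite mulrCA [leRHS]mulrC ler_pdivlMr ?exprn_gt0 // mul1r.
Qed.

Lemma irr_char_bounds (n : nat) (chi : 'S_n -> R[i]) (d : nat) :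
  is_irr_char chi -> has_level chi d ->
  exists m : nat, [/\ (0 < m)%N, (d <= n)%N, chi 1%g = m%:R,
    forall s, `|chi s| <= (m%:R)%:C%C
  & (0 < d)%N -> (4 * d <= n)%N -> forall s, `|chi s| <=
    (m%:R * ((4 * expR 2 * d%:R / n%:R) ^+ d *
             #|bounded_invariant_sets s d|%:R))%:C%C].
Proof.
move=> [m [rG [irr chiE]]] [la [laP chila dE]]; exists m.
have chi1 : chi 1%g = m%:R by rewrite chiE repr_mx1 mxtrace1.
split=> //.
- by have [] := (mx_irrP rG).1 irr.
- by rewrite dE /partition_level; lia.
- move=> s; rewrite rmorph_nat -chi1 !chiE; exact: char_norm_le1.
move=> d0 dn s.
have rla u : \tr (rG u) = specht_char R[i] la u by rewrite -chiE chila.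
have C0 : 0 < 'C(n, d)%:R :> R[i] by rewrite ltr0n bin_gt0; lia.
rewrite -(ler_pM2r C0) chiE.
have := level_char_decay irr laP rla s; rewrite -dE repr_mx1 mxtrace1.
move=> /(_ ltac:(lia)) /le_trans; apply.
have t0 : 0 <= d%:R / (n - 2 * d)%:R :> R[i] by rewrite divr_ge0.
have m0 : 0 <= m%:R :> R[i] by [].
apply: le_trans (ler_wpM2l m0 (boundary_sum s d t0)) _.
have -> : m%:R * (#|bounded_invariant_sets s d|%:R *
     (2 ^+ d * (1 + d%:R / (n - 2 * d)%:R) ^+ n)) =
   (m%:R * (#|bounded_invariant_sets s d|%:R *
     (2 ^+ d * (1 + d%:R / (n - 2 * d)%:R) ^+ n)))%:C%C :> R[i].
  by rewrite !(rmorphM, rmorphXn, rmorphD, fmorphV, rmorph1, rmorph_nat).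
rewrite -[X in _ <= _ * X](rmorph_nat (real_complex R)) -rmorphM lecR /=.
rewrite -[leRHS]mulrA ler_wpM2l // [leRHS]mulrAC [leRHS]mulrC ler_wpM2l //.
exact: boundary_constant.
Qed.

Lemma norm_inner_le (n : nat) (f : 'S_n -> R) (chi : 'S_n -> R[i]) (b : 'S_n -> R) :
  (forall s, `|chi s| <= (b s)%:C%C) ->
  complex.Re `|inner (fun s => (f s)%:C%C) chi| <= (n`!%:R)^-1 * \sum_s `|f s| * b s.
Proof.
move=> chib.
have : `|inner (fun s => (f s)%:C%C) chi| <=
    ((n`!%:R)^-1 * \sum_s `|f s| * b s)%:C%C.
  rewrite /inner normrM rmorphM fmorphV rmorph_nat normfV normr_nat.
  rewrite ler_wpM2l ?invr_ge0 // rmorph_sum.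
  apply: le_trans (ler_norm_sum _ _ _) _; apply: ler_sum => s _.
  rewrite normrM rmorphM normc_def /= expr0n addr0 sqrtr_sqr.
  by rewrite ler_wpM2l // lecR.
by rewrite lecE => /andP[].
Qed.

Lemma pnorm1E (n : nat) (f : 'S_n -> R) : pnorm 1 f = (n`!%:R)^-1 * \sum_s `|f s|.
Proof.
rewrite /pnorm invr1 powRr1; last first.
  by rewrite mulr_ge0 ?invr_ge0 // sumr_ge0 // => s _; rewrite powR_ge0.
by congr (_ * _); apply: eq_bigr => s _; rewrite powRr1.
Qed.

Lemma pnorm2E (n : nat) (f : 'S_n -> R) :
  pnorm 2 f ^+ 2 = (n`!%:R)^-1 * \sum_s `|f s| ^+ 2.
Proof.
have E : \sum_s `|f s| `^ 2 = \sum_s `|f s| ^+ 2.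
  by apply: eq_bigr => s _; rewrite powR_mulrn.
rewrite /pnorm E powR12_sqrt ?sqr_sqrtr // mulr_ge0 ?invr_ge0 // sumr_ge0 // => s _;
  exact: exprn_ge0.
Qed.

(** With q = ln M / d and q < k <= 2 q, the moment of order 2 k bounds the
    integral of |f| against the number of invariant sets; the factor M, spread
    over k-th roots, costs at most e ^ d because ln M = q d <= k d. *)
Lemma level_bound (n : nat) (f : 'S_n -> R) (M : R) (chi : 'S_n -> R[i]) (d : nat) :
  (exists s : 'S_n, f s != 0) -> pnorm 2 f / pnorm 1 f <= M ->
  is_irr_char chi -> has_level chi d -> (0 < d)%N -> d%:R < ln M ->
  complex.Re `|inner (fun s => (f s)%:C%C) chi| <=
    complex.Re (chi 1%g) * pnorm 1 f *
    (32 * expR 5 * ln M / (n%:R * ln (ln M / d%:R))) ^+ d.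
Proof.
move=> [s0 fs0] fM irr lev d0 dM.
have [m [m0 dn chi1 triv decay]] := irr_char_bounds irr lev.
have N0 : 0 < n`!%:R :> R by rewrite ltr0n fact_gt0.
have n0 : 0 < n%:R :> R by rewrite ltr0n; lia.
have d0R : 0 < d%:R :> R by rewrite ltr0n.
have -> : complex.Re (chi 1%g) = m%:R by rewrite chi1 -(rmorph_nat (real_complex R)).
set q := ln M / d%:R.
have q1 : 1 < q by rewrite ltr_pdivlMr // mul1r.
have lq0 : 0 < ln q by rewrite ln_gt0.
have lM : ln M = q * d%:R by rewrite /q divfK // gt_eqF.
have lM0 : 0 < ln M by apply: lt_trans dM.
have M0 : 0 < M by rewrite ltNge; apply: contraTN lM0 => M0; rewrite ln0 ?ltxx.
have S0 : 0 < \sum_s `|f s|.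
  rewrite (bigD1 s0) //= ltr_pwDl ?normr_gt0 // sumr_ge0 // => s _.
rewrite pnorm1E in fM *.
have p0 : 0 < (n`!%:R)^-1 * \sum_s `|f s| by rewrite mulr_gt0 ?invr_gt0.
have [dn4|dn4] := ltnP n (4 * d).
  (* Here the factor on the right is at least 1, as n <= 4 d and ln q <= q. *)
  apply: le_trans (norm_inner_le f (b := fun=> m%:R) triv) _.
  rewrite -mulr_suml mulrA [leLHS]mulrC ler_peMr //.
    by rewrite mulr_ge0 // ltW.
  rewrite exprn_ege1 // ler_pdivlMr ?mulr_gt0 // mul1r lM.
  have e1 := expR_ge1Dx (5 : R).
  have lqq : ln q <= q by rewrite ltW // ln_sublinear // (lt_trans _ q1).
  have n4 : n%:R <= 4 * d%:R :> R by rewrite -natrM ler_nat ltnW.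
  apply: le_trans (_ : (4 * d%:R) * q <= _).
    by apply: ler_pM => //; apply: ltW.
  have qd : 0 < q * d%:R by rewrite mulr_gt0 // (lt_trans _ q1).
  by nra.
have [k qk k2] : exists2 k : nat, q < k%:R & k%:R <= 2 * q.
  have /andP[kq qk] := truncn_itv (ltW (lt_trans ltr01 q1)).
  exists (Num.truncn q).+1 => //.
  by rewrite -addn1 natrD; move: kq q1; lra.
have k1 : (1 < k)%N by rewrite -(ltr_nat R) (lt_trans q1).
have Q1 : (1 < 2 * k)%N by rewrite mul2n -addnn ltn_addr.
have Q0 : (0 < 2 * k)%N by apply: ltnW.
pose y := (2 * k)%:R / ln (2 * k)%:R : R.
have Qq : q <= (2 * k)%:R by rewrite natrM; move: qk q1; lra.
have lQ : ln q <= ln (2 * k)%:R.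
  by rewrite ler_ln ?posrE ?ltr0n ?(lt_trans _ q1).
have lQ0 : 0 < ln (2 * k)%:R :> R := lt_le_trans lq0 lQ.
have y0 : 0 < y by rewrite divr_gt0 // ltr0n.
have yq : y <= 4 * q / ln q.
  rewrite /y ler_pM ?invr_ge0 ?(ltW lQ0) //; first by rewrite natrM; move: k2; lra.
  by rewrite lef_pV2.
(* The last factor of B absorbs M, since M = e ^ (q d) <= (e ^ d) ^ k. *)
pose B := expR 2 * y ^+ d * expR 1 ^+ d.
have B0 : 0 < B by rewrite !mulr_gt0 ?exprn_gt0 ?expR_gt0.
have f2 : n`!%:R * \sum_s `|f s| ^+ 2 <= (M * \sum_s `|f s|) ^+ 2.
  have := fM; rewrite ler_pdivrMr // => fM'.
  have : pnorm 2 f ^+ 2 <= (M * ((n`!%:R)^-1 * \sum_s `|f s|)) ^+ 2.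
    by rewrite lerXn2r // ?nnegrE ?powR_ge0 // mulr_ge0 // ltW.
  rewrite pnorm2E => /(ler_wpM2l (ltW (exprn_gt0 2 N0))).
  set S := \sum_s `|f s|; set S2 := \sum_s `|f s| ^+ 2.
  have -> : n`!%:R ^+ 2 * ((n`!%:R)^-1 * S2) = n`!%:R * S2.
    by field; rewrite gt_eqF.
  have -> // : n`!%:R ^+ 2 * (M * ((n`!%:R)^-1 * S)) ^+ 2 = (M * S) ^+ 2.
  by field; rewrite gt_eqF.
have X2 : M ^+ 2 * \sum_(s : 'S_n) #|bounded_invariant_sets s d|%:R ^+ (2 * k) <=
    n`!%:R * B ^+ (2 * k).
  rewrite /B exprMn mulrA mulrC; apply: ler_pM.
  - by apply: sumr_ge0 => s _; rewrite exprn_ge0.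
  - by rewrite exprn_ge0 // ltW.
  - exact: invariant_sets_log_moment.
  have -> : (expR 1 ^+ d) ^+ (2 * k) = (expR 1 ^+ (d * k)) ^+ 2 :> R.
    by rewrite -!exprM mulnCA mulnC.
  rewrite lerXn2r ?nnegrE ?exprn_ge0 ?expR_ge0 ?(ltW M0) //.
  rewrite -[leLHS]lnK ?posrE // lM -expRM_natl mulr1 ler_expR.
  by rewrite mulnC natrM ler_wpM2r // ltW.
have yS : \sum_s `|f s| * #|bounded_invariant_sets s d|%:R <= 2 * B * \sum_s `|f s|.
  apply: (weighted_sum_le (k := k) (M := M) (E := n`!%:R)) => //.
  exact: ltn_trans k1.
set A := 4 * expR 2 * d%:R / n%:R : R.
have A0 : 0 <= A by rewrite !mulr_ge0 ?invr_ge0 ?expR_ge0.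
apply: le_trans (norm_inner_le f (decay d0 dn4)) _; rewrite -/A.
have -> : \sum_s `|f s| * (m%:R * (A ^+ d * #|bounded_invariant_sets s d|%:R)) =
    m%:R * A ^+ d * \sum_s `|f s| * #|bounded_invariant_sets s d|%:R.
  by rewrite mulr_sumr; apply: eq_bigr => s _; ring.
apply: le_trans (_ : (n`!%:R)^-1 * (m%:R * A ^+ d * (2 * B * \sum_s `|f s|)) <= _).
  by rewrite ler_wpM2l ?invr_ge0 // ler_wpM2l // mulr_ge0 ?exprn_ge0.
have -> : (n`!%:R)^-1 * (m%:R * A ^+ d * (2 * B * \sum_s `|f s|)) =
    m%:R * ((n`!%:R)^-1 * \sum_s `|f s|) * (A ^+ d * (2 * B)) by ring.
(* Constants are absorbed into the d-th power, as d >= 1; then 8 e ^ 5 collects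
   2 e ^ 3 and the constant of A, and y <= 4 q / ln q turns 8 into 32. *)
rewrite ler_wpM2l //; first by rewrite mulr_ge0 // ltW.
apply: le_trans (_ : (A * (2 * (expR 2 * y * expR 1))) ^+ d <= _).
  rewrite (exprMn d A) (exprMn d 2) (exprMn d (expR 2 * y)) (exprMn d (expR 2)).
  rewrite ler_wpM2l ?exprn_ge0 //; apply: ler_pM => //; first exact: ltW.
    by rewrite -[leLHS]expr1 ler_weXn2l // ler1n.
  rewrite /B !ler_wpM2r ?exprn_ge0 ?expR_ge0 ?(ltW y0) //.
  rewrite -[leLHS]expr1 ler_weXn2l //.
  by rewrite -[leLHS]expR0 ler_expR.
rewrite lerXn2r ?nnegrE //.
- by rewrite (mulr_ge0 A0) // mulr_ge0 // mulr_ge0 ?expR_ge0 // mulr_ge0 ?expR_ge0 // ltW.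
- by apply: divr_ge0; apply: mulr_ge0; rewrite ?mulr_ge0 ?expR_ge0 ?(ltW lM0) ?(ltW lq0).
have e5 : expR 5 = expR 2 * expR 2 * expR 1 :> R by rewrite -!expRD; congr expR; ring.
have -> : A * (2 * (expR 2 * y * expR 1)) = (8 * expR 5 * d%:R / n%:R) * y.
  by rewrite /A e5; field; rewrite gt_eqF.
have -> : 32 * expR 5 * ln M / (n%:R * ln q) =
    (8 * expR 5 * d%:R / n%:R) * (4 * q / ln q).
  by rewrite lM; field; rewrite !gt_eqF.
by rewrite ler_wpM2l // !mulr_ge0 ?invr_ge0 ?expR_ge0.
Qed.

End Final.

Theorem theorem2p5 (R : realType) :
  exists C : R, 0 < C /\
    forall (n : nat) (f : 'S_n -> R) (M : R) (chi : 'S_n -> R[i]) (d : nat),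
      is_class_function f ->
      (exists s : 'S_n, f s != 0) ->
      pnorm 2 f / pnorm 1 f <= M ->
      is_irr_char chi ->
      has_level chi d ->
      d%:R <= ln M ->
      ((complex.Re `|inner (fun s => (f s)%:C%C) chi|)%:E <=
         (complex.Re (chi 1%g) * pnorm 1 f)%:E * level_factor C n M d)%E.
Proof.
exists (32 * expR 5); split; first by rewrite mulr_gt0 ?expR_gt0.
move=> n f M chi d _ [s0 fs0] fM irr lev dM.
have [m [m0 _ chi1 triv _]] := irr_char_bounds irr lev.
have Re1 : complex.Re (chi 1%g) = m%:R by rewrite chi1 -(rmorph_nat (real_complex R)).
rewrite /level_factor; have [->|d0] := posnP d.
  rewrite expr0 mule1 lee_fin Re1 pnorm1E mulrCA.
  apply: le_trans (norm_inner_le f (b := fun=> m%:R) triv) _.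
  by rewrite -mulr_suml [_ * m%:R]mulrC.
have [dE|dE] := eqVneq (d%:R : R) (ln M) => /=.
  rewrite gt0_muley ?leey // lte_fin Re1 mulr_gt0 ?ltr0n //.
  rewrite pnorm1E mulr_gt0 ?invr_gt0 ?ltr0n ?fact_gt0 // (bigD1 s0) //=.
  by rewrite ltr_pwDl ?normr_gt0 // sumr_ge0.
rewrite -EFinM lee_fin; apply: level_bound => //; first by exists s0.
by rewrite lt_neqAle dE.
Qed.
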